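(* Let $\Omega=(0,\xi_l+\delta)\subset\Omega_0=(0,1)$ be obtained by trimming off the right end of $\Omega_0$ between two consecutive distinct knots $\xi_l<\xi_{l+1}$, where $0<\delta<\xi_{l+1}-\xi_l$ and $\xi_l$ is an internal knot of multiplicity $m_l=p-\kappa_l$ with $1\le m_l\le p$ (so the degree-$p$ spline space is $C^{\kappa_l}$ across $\xi_l$). Let $K$ and $\hat M$ be the stiffness and row-sum lumped mass matrices of the trimmed degree-$p$ B-spline discretization. With the knot vector and $p$ fixed, as $\delta\to0$: $$\lambda_n(K,\hat M)\sim\begin{cases}\delta^{-1}&\text{if }\kappa_l=0,\\ 1&\text{otherwise,}\end{cases}$$ and $$\lambda_1(K,\hat M)\le\min_i\frac{K_{ii}}{\hat M_{ii}}=\begin{cases}\mathcal O(1)&\text{if }p\le2,\\ \mathcal O(\delta^{p-2})&\text{otherwise.}\end{cases}$$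
   Context: The B-splines of degree $p\ge1$ on $[0,1]$ are built from an open knot vector (first and last knot repeated $p+1$ times) with internal knots of multiplicity between $1$ and $p$. The active basis $\varphi_1,\dots,\varphi_n$ consists of those B-splines whose support intersects $\Omega$; a homogeneous Dirichlet condition is strongly imposed at the untrimmed left end $0$ (B-splines not vanishing there are discarded) and a homogeneous Neumann condition holds at the trimmed end $\xi_l+\delta$. The stiffness matrix is $K_{ij}=\int_\Omega\varphi_i'\varphi_j'$. The row-sum lumped mass matrix (row sums taken before elimination of the Dirichlet degree of freedom, using partition of unity) is the diagonal matrix $\hat M$ with $\hat M_{ii}=\int_\Omega\varphi_i$. The generalized eigenvalues of $(K,\hat M)$ (values $\lambda$ with $K\bm x=\lambda\hat M\bm x$, $\bm x\ne0$) are ordered $\lambda_1(K,\hat M)\le\dots\le\lambda_n(K,\hat M)$. For positive functions $f,g$ of $\delta$, $f\sim g$ as $\delta\to0$ means that $f$ and $g$ are of the same order, i.e. $c\,g(\delta)\le f(\delta)\le C\,g(\delta)$ for all sufficiently small $\delta$, with constants $0<c\le C$ independent of $\delta$. *)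

(* Defs.v *)
From HB Require Import structures.
From mathcomp Require Import all_boot all_order all_algebra.
From mathcomp Require Import all_classical all_reals all_analysis.

Set Implicit Arguments.
Unset Strict Implicit.
Unset Printing Implicit Defensive.

Import Order.TTheory GRing.Theory Num.Theory.
Import numFieldNormedType.Exports.

Local Open Scope classical_set_scope.
Local Open Scope ring_scope.

(* Open knot vector of degree p on [0, 1].  Knots are listed with repetition,
   so the multiplicity of a knot x is [count_mem x xi]. *)
Definition open_knot_vector (R : realType) (p : nat) (xi : seq R) : Prop :=
  [/\ sorted <=%R xi,
      {in xi, forall x, 0 <= x <= 1},
      count_mem 0 xi = p.+1,
      count_mem 1 xi = p.+1 &
      {in xi, forall x, 0 < x < 1 -> (1 <= count_mem x xi <= p)%N}].

(* [undup] preserves the order of a sorted sequence, so this is the increasing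
   list of distinct knots, indexed from 0 (first knot 0, last knot 1). *)
Definition distinct_knots (R : realType) (xi : seq R) : seq R := undup xi.

Definition distinct_knot (R : realType) (xi : seq R) (l : nat) : R :=
  (distinct_knots xi)`_l.

Definition knot_mult (R : realType) (xi : seq R) (l : nat) : nat :=
  count_mem (distinct_knot xi l) xi.

(* Cox-de Boor recursion.  The usual convention 0 / 0 = 0 for coinciding knots
   is automatic since 0^-1 = 0.  With half-open intervals all the splines vanish
   at x = 1; this plays no role on domains ]0, T[ with T < 1. *)
Fixpoint bspline (R : realType) (xi : seq R) (p i : nat) (x : R) : R :=
  match p with
  | 0 => if xi`_i <= x < xi`_i.+1 then 1 else 0
  | q.+1 =>
      (x - xi`_i) / (xi`_(i + q.+1) - xi`_i) * bspline xi q i x +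
      (xi`_(i + q.+2) - x) / (xi`_(i + q.+2) - xi`_i.+1) * bspline xi q i.+1 x
  end.

Definition n_bsplines (R : realType) (p : nat) (xi : seq R) : nat :=
  (size xi - p.+1)%N.

Definition trimmed_domain (R : realType) (T : R) : set R := `]0, T[.

Definition bspline_support (R : realType) (p : nat) (xi : seq R) (i : nat) :
    set R :=
  closure [set x | bspline xi p i x != 0].

(* Indices of the B-splines whose support meets ]0, T[ and which satisfy the
   homogeneous Dirichlet condition at 0. *)
Definition active (R : realType) (p : nat) (xi : seq R) (T : R) :
    {set 'I_(n_bsplines p xi)} :=
  [set i : 'I_(n_bsplines p xi) |
     `[< bspline_support p xi i `&` trimmed_domain T !=set0 >]
     && (bspline xi p i 0 == 0)]%SET.

Definition n_active (R : realType) (p : nat) (xi : seq R) (T : R) : nat :=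
  #|active p xi T|.

Definition basis (R : realType) (p : nat) (xi : seq R) (T : R)
    (i : 'I_(n_active p xi T)) : R -> R :=
  bspline xi p (enum_val i).

(* Derivatives are pointwise; they fail to exist at finitely many knots at most,
   which the Lebesgue integral does not see. *)
Definition stiffness (R : realType) (p : nat) (xi : seq R) (T : R) :
    'M[R]_(n_active p xi T) :=
  \matrix_(i < n_active p xi T, j < n_active p xi T)
    \int[lebesgue_measure]_(x in trimmed_domain T)
      (derive1 (basis i) x * derive1 (basis j) x).

(* By partition of unity, the sum of the mass-matrix entries \int phi_i phi_j
   over all B-splines phi_j, those not vanishing at 0 included, is
   \int phi_i. *)
Definition lumped_mass (R : realType) (p : nat) (xi : seq R) (T : R) :
    'M[R]_(n_active p xi T) :=
  diag_mx (\row_(i < n_active p xi T)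
    \int[lebesgue_measure]_(x in trimmed_domain T) basis i x).

(* s lists in nondecreasing order, with multiplicity, the n generalized
   eigenvalues of (K, M): the columns of X are a basis of eigenvectors.  Such
   an s is unique when M is invertible, and exists when K is symmetric and M is
   symmetric positive definite. *)
Definition ordered_gen_eigenvalues (R : realType) (n : nat) (K M : 'M[R]_n)
    (s : seq R) : Prop :=
  [/\ size s = n, sorted <=%R s &
      exists2 X : 'M[R]_n, X \in unitmx &
        forall k : 'I_n, K *m col k X = s`_k *: (M *m col k X)].

Definition gen_eigenvalues (R : realType) (n : nat) (K M : 'M[R]_n) : seq R :=
  xget [::] [set s | ordered_gen_eigenvalues K M s].

(* lambda_k (K, M), with k counted from 1. *)
Definition gen_eigenvalue (R : realType) (n : nat) (K M : 'M[R]_n)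
    (k : nat) : R :=
  (gen_eigenvalues K M)`_k.-1.

(* min_i K_ii / M_ii; the value for n = 0 is a default. *)
Definition min_diag_ratio (R : realType) (n : nat) (K M : 'M[R]_n) : R :=
  let s := [seq K i i / M i i | i : 'I_n] in
  \big[Num.min/head 0 s]_(r <- s) r.

(* f ~ g as delta tends to 0 from the right. *)
Definition same_order (R : realType) (f g : R -> R) : Prop :=
  exists c C : R, 0 < c <= C /\
    \forall delta \near 0^'+, c * g delta <= f delta <= C * g delta.

(* Main.v *)
Require Import Defs.
From HB Require Import structures.
From mathcomp Require Import all_boot all_order all_algebra.
From mathcomp Require Import fingroup perm.
From mathcomp Require Import all_classical all_reals all_analysis.
From mathcomp Require Import measurable_realfun.
From mathcomp Require Import complex spectral.
From mathcomp Require Import ring lra zify.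

(* Since K is positive semidefinite and M is a positive
   diagonal matrix, the eigenvalues are nonnegative and sum to the trace of
   M^-1 K, so lambda_n is comparable to the largest diagonal ratio K_ii / M_ii;
   and lambda_1 is at most each diagonal ratio, because K_ii / M_ii is a convex
   combination of the eigenvalues (spectral theorem for M^-1/2 K M^-1/2).  It
   remains to estimate the diagonal ratios.  To the right of its first knot a, a
   B-spline is a polynomial (x - a)^q Q with Q(a) > 0, where q is p minus the
   number of further copies of a in its own knots.  If a < xi_l the ratio stays
   bounded; if a = xi_l then K_ii ~ delta^(2q-1) and M_ii ~ delta^(q+1), so that
   the ratio is of order delta^(q-2).  Over the splines starting at xi_l, q
   ranges from kappa_l + 1 to p. *)

Set Implicit Arguments.
Unset Strict Implicit.
Unset Printing Implicit Defensive.

Import Order.TTheory GRing.Theory Num.Theory.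
Import numFieldNormedType.Exports.

Local Open Scope classical_set_scope.
Local Open Scope ring_scope.

(** * Generalized eigenvalues *)

(** The type of active indices changes with [delta], so all estimates concern splines indexed by the
    fixed type ['I_(n_bsplines p xi)], and the finitely many constants are merged at the end. They
    are inequalities between [energy] and [mass], with powers of [delta] multiplied out where
    needed, because the exponent q - 2 is negative for q = 1. The derivative used is [dbspline],
    obtained by differentiating the recursion formally: unlike a pointwise derivative it is visibly
    bounded on [0, 1] and measurable. Lower bounds on the energy occur only for q = 1, where the
    derivative stays away from 0 near the first knot. Such a spline starts at xi_l when kappa_l = 0,
    and one always starts at 0, namely the spline of index 1. The latter is active for every
    [delta]; it gives the lower bound on lambda_n when kappa_l > 0 and the bound O(1) on the
    smallest ratio when p <= 2. *)

(** Over [R[i]] the matrix is Hermitian, hence unitarily diagonalizable with real eigenvalues, and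
    the similarity descends to [R]. The descended [Q] is only known to be invertible, so the convex
    weights are read off the unitary matrix [U]: they are the squared moduli in its column i. *)
Lemma real_symmetric_spectral (R : realType) (n : nat) (A : 'M[R]_n) :
  A^T = A ->
  exists d : 'rV[R]_n,
    (exists2 Q : 'M[R]_n, Q \in unitmx & Q *m A = diag_mx d *m Q) /\
    (forall i, exists2 w : 'I_n -> R, (forall k, 0 <= w k) /\ \sum_k w k = 1 &
       A i i = \sum_k w k * d 0 k).
Proof.
move=> symA; pose toC := @map_mx _ _ (real_complex R).
pose B : 'M[R[i]]_n := toC n n A.
have realC (a : R) : real_complex R a \is Num.real.
  by apply/complex_realP; exists a.
have Breal : B \is a mxOver Num.real by apply/mxOverP => i j; rewrite mxE.
have Bherm : B \is hermitianmx n false Num.conj.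
  apply: realsym_hermsym => //; apply/is_hermitianmxP.
  by rewrite expr0 scale1r map_mx_id // /B /toC map_trmx symA.
have Breald := hermitian_spectral_diag_real Bherm.
have /hermitian_normalmx/orthomx_spectralP := Bherm.
move: Breald (spectral_unit B) (spectral_unitarymx B).
move: (spectralmx B) (spectral_diag B) => U dC Breald Uunit Uunitary BE.
have BA : B = toC n n A by [].
clearbody B.
pose d : 'rV[R]_n := map_mx (@complex.Re R) dC.
have dE : dC = toC _ _ d.
  apply/matrixP => i j; rewrite /toC !mxE RRe_real //.
  by move/mxOverP: Breald; apply.
exists d; split.
  have sim : similar_in unitmx B (diag_mx dC).
    exists U; first exact: Uunit.
    apply/(similarP Uunit).
    by rewrite BE !mulmxA mulmxV // mul1mx.
  have [||Q] := real_similar sim.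
  - by [].
  - apply/mxOverP => i j; rewrite dE /toC !mxE.
    by case: (i == j); rewrite ?mulr1n ?mulr0n ?rpred0.
  rewrite inE => /andP[/= /mxOverP Qreal Qunit] /(similarP Qunit) QE.
  have [Qr QR] : exists Qr, Q = toC _ _ Qr.
    exists (map_mx (@complex.Re R) Q).
    by apply/matrixP => i j; rewrite /toC !mxE RRe_real //; exact: Qreal.
  exists Qr; first by rewrite -(map_unitmx (real_complex R)) -/(toC _ _ _) -QR.
  by move: QE; rewrite QR BA dE /toC -map_diag_mx -!map_mxM; exact: map_mx_inj.
move=> i.
pose w k : R := complex.Re (U k i) ^+ 2 + complex.Im (U k i) ^+ 2.
have wE k : real_complex R (w k) = (U k i)^* * U k i.
  rewrite /w add_Re2_Im2. rewrite normCKC. by [].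
exists w.
  split=> [k|]; first by rewrite addr_ge0 ?sqr_ge0.
  apply: (@complexI R); rewrite rmorph_sum rmorph1 /=.
  under eq_bigr do rewrite wE.
  have := mulVmx Uunit; rewrite invmx_unitary // => /matrixP/(_ i i).
  rewrite !mxE eqxx mulr1n => <-.
  by apply: eq_bigr => k _; rewrite !mxE.
apply: (@complexI R); rewrite rmorph_sum /=.
have -> : real_complex R (A i i) = B i i by rewrite BA mxE.
rewrite BE invmx_unitary // !mxE; apply: eq_bigr => k _.
rewrite rmorphM /= wE mul_mx_diag !mxE dE /toC !mxE.
by rewrite mulrAC.
Qed.

Lemma pencil_spectral (R : realType) (n : nat) (K : 'M[R]_n) (m : 'rV[R]_n) :
  K^T = K -> (forall i, 0 < m 0 i) ->
  exists d : 'rV[R]_n,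
    (exists2 X : 'M[R]_n, X \in unitmx &
       K *m X = diag_mx m *m X *m diag_mx d) /\
    (forall i, exists2 w : 'I_n -> R, (forall k, 0 <= w k) /\ \sum_k w k = 1 &
       K i i / m 0 i = \sum_k w k * d 0 k).
Proof.
move=> symK m_gt0.
pose T : 'M[R]_n := diag_mx (\row_i Num.sqrt (m 0 i)).
pose S : 'M[R]_n := diag_mx (\row_i (Num.sqrt (m 0 i))^-1).
have sqrt_neq0 i : Num.sqrt (m 0 i) != 0 by rewrite gt_eqF // sqrtr_gt0.
have TS : T *m S = 1%:M.
  rewrite mulmx_diag; apply/matrixP => i j; rewrite !mxE.
  by case: eqP => [->|_]; rewrite ?mulr0n // mulfV.
have mS : diag_mx m *m S = T.
  rewrite mulmx_diag; apply/matrixP => i j; rewrite !mxE.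
  case: eqP => [->|_]; rewrite ?mulr0n // -{1}[m 0 j]sqr_sqrtr ?ltW //.
  by rewrite expr2 mulfK.
have [|d [[Q Qunit QE] diagE]] := @real_symmetric_spectral R n (S *m K *m S).
  by rewrite !trmx_mul !tr_diag_mx symK mulmxA.
(* By symmetry of [S *m K *m S], transposition turns the rows of [Q], which are left eigenvectors,
   into columns of eigenvectors. *)
have QE' : S *m K *m S *m Q^T = Q^T *m diag_mx d.
  move/(congr1 (@trmx _ _ _)): QE.
  by rewrite !trmx_mul !tr_diag_mx symK !mulmxA.
exists d; split.
  exists (S *m Q^T).
    rewrite unitmx_mul unitmx_tr Qunit andbT.
    by have := mulmx1_unit TS; case.
  rewrite !mulmxA mS -[RHS]mulmxA -QE'.
  by rewrite !mulmxA TS mul1mx.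
move=> i; have [w w_ge0 wE] := diagE i; exists w => //.
rewrite -wE /S mul_mx_diag mxE mul_diag_mx !mxE.
by rewrite mulrAC -invfM -expr2 sqr_sqrtr ?ltW // mulrC.
Qed.

Lemma col_mul (R : pzSemiRingType) (m n p : nat) (A : 'M[R]_(m, n)) (B : 'M[R]_(n, p))
    (k : 'I_p) :
  col k (A *m B) = A *m col k B.
Proof. by rewrite !colE mulmxA. Qed.

Lemma mul_col_diag_eqP (R : realType) (n : nat) (K M X : 'M[R]_n) (s : seq R) :
  (forall k : 'I_n, K *m col k X = s`_k *: (M *m col k X)) <->
  K *m X = M *m X *m diag_mx (\row_k s`_k).
Proof.
have colE (k : 'I_n) : col k (M *m X *m diag_mx (\row_k s`_k)) =
    s`_k *: (M *m col k X).
  by rewrite -col_mul; apply/matrixP => i j; rewrite mul_mx_diag !mxE mulrC.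
split=> [eqK|eqK k]; last by rewrite -colE -eqK col_mul.
apply/matrixP => i k; have /matrixP/(_ i 0) := eqK k.
by rewrite -colE -col_mul !mxE.
Qed.

(** Sorting the eigenvalues amounts to a permutation [g], and the columns of [X] are permuted along
    with them. *)
Lemma ordered_gen_eigenvalues_exist (R : realType) (n : nat) (K : 'M[R]_n)
    (m : 'rV[R]_n) :
  K^T = K -> (forall i, 0 < m 0 i) ->
  exists s, ordered_gen_eigenvalues K (diag_mx m) s.
Proof.
move=> symK m_gt0; have [d [[X Xunit XE] _]] := pencil_spectral symK m_gt0.
pose t := [tuple d 0 i | i < n].
have /tuple_permP[g gE] : perm_eq (sort_tuple <=%R t) t by rewrite perm_sort.
exists (sort <=%R t); split; first by rewrite size_sort size_tuple.
  exact: sort_le_sorted.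
exists (col_perm g X).
  by rewrite col_permE unitmx_mul Xunit unitmx_perm.
move=> k; have -> : (sort <=%R t)`_k = d 0 (g k).
  rewrite [sort _ _]gE (nth_map k) ?size_enum_ord // nth_ord_enum.
  by rewrite !tnth_mktuple.
have -> : col k (col_perm g X) = col (g k) X by apply/matrixP => i j; rewrite !mxE.
rewrite -!col_mul XE; apply/matrixP => i j.
by rewrite mul_mx_diag !mxE mulrC.
Qed.

(** [gen_eigenvalues] is a choice with default [[::]]; existence is what gives it content. *)
Lemma gen_eigenvaluesP (R : realType) (n : nat) (K : 'M[R]_n) (m : 'rV[R]_n) :
  K^T = K -> (forall i, 0 < m 0 i) ->
  ordered_gen_eigenvalues K (diag_mx m) (gen_eigenvalues K (diag_mx m)).
Proof.
by move=> symK /(ordered_gen_eigenvalues_exist symK); exact: xgetPex.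
Qed.

(** Expanding the eigenvector in the basis [X], any nonzero coordinate [y k] forces a = s_k. This
    locates the eigenvalues given by [pencil_spectral] in an arbitrary ordered list. *)
Lemma ordered_gen_eigenvalues_mem (R : realType) (n : nat) (K : 'M[R]_n)
    (m : 'rV[R]_n) (s : seq R) (a : R) (x : 'cV[R]_n) :
  (forall i, 0 < m 0 i) -> ordered_gen_eigenvalues K (diag_mx m) s ->
  x != 0 -> K *m x = a *: (diag_mx m *m x) -> exists k : 'I_n, a = s`_k.
Proof.
move=> m_gt0 [_ _ [X Xunit /mul_col_diag_eqP XE]] x_neq0 xE.
pose y := invmx X *m x.
have xy : x = X *m y by rewrite mulKVmx.
have y_neq0 : y != 0 by apply: contraNneq x_neq0 => y0; rewrite xy y0 mulmx0.
have [k yk] : exists k, y k 0 != 0.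
  apply/existsP; apply: contraNT y_neq0; rewrite negb_exists => /forallP y0.
  by apply/eqP/matrixP => i j; rewrite ord1 [RHS]mxE; apply/eqP/negbNE.
exists k.
have Munit : diag_mx m *m X \in unitmx.
  rewrite unitmx_mul Xunit andbT unitmxE det_diag unitfE.
  by apply/prodf_neq0 => i _; rewrite gt_eqF.
have : diag_mx (\row_k s`_k) *m y = a *: y.
  apply: (can_inj (mulKmx Munit)).
  by rewrite mulmxA -XE -mulmxA -xy xE -scalemxAr -[_ *m X *m y]mulmxA -xy.
move/matrixP/(_ k 0); rewrite mul_diag_mx [LHS]mxE [X in _ = X -> _]mxE [X in X * _]mxE.
by move/(mulIf yk).
Qed.

Lemma ordered_gen_eigenvalues_min (R : realType) (n : nat) (K : 'M[R]_n)
    (m : 'rV[R]_n) (s : seq R) :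
  K^T = K -> (forall i, 0 < m 0 i) -> ordered_gen_eigenvalues K (diag_mx m) s ->
  forall i, s`_0 <= K i i / m 0 i.
Proof.
move=> symK m_gt0 s_eig i; have [sz ss _] := s_eig.
have [d [[X Xunit XE] /(_ i)[w [w_ge0 w_sum] ->]]] := pencil_spectral symK m_gt0.
have s0_le k : s`_0 <= d 0 k.
  have [||j ->] := @ordered_gen_eigenvalues_mem _ _ _ _ _ (d 0 k) (col k X) m_gt0 s_eig.
  - apply: contraTneq Xunit => Xk0; rewrite -unitmx_tr unitmxE.
    rewrite (expand_det_row _ k) big1 ?unitr0 // => j _.
    by have /matrixP/(_ j 0) := Xk0; rewrite !mxE => ->; rewrite mul0r.
  - rewrite -!col_mul XE; apply/matrixP => a b.
    by rewrite mul_mx_diag !mxE mulrC.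
  - by apply: le_sorted_leq_nth => //; rewrite inE ?sz // (leq_ltn_trans _ (ltn_ord j)).
rewrite -[s`_0]mul1r -w_sum mulr_suml; apply: ler_sum => k _.
exact: ler_wpM2l.
Qed.

(** The basis [X] conjugates M^-1 K to the diagonal matrix of [s], and the trace is invariant under
    conjugation. *)
Lemma ordered_gen_eigenvalues_sum (R : realType) (n : nat) (K : 'M[R]_n)
    (m : 'rV[R]_n) (s : seq R) :
  (forall i, 0 < m 0 i) -> ordered_gen_eigenvalues K (diag_mx m) s ->
  \sum_(k < n) s`_k = \sum_i K i i / m 0 i.
Proof.
move=> m_gt0 [_ _ [X Xunit /mul_col_diag_eqP XE]].
pose W : 'M[R]_n := diag_mx (\row_i (m 0 i)^-1).
have Wm : W *m diag_mx m = 1%:M.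
  rewrite mulmx_diag; apply/matrixP => i j; rewrite !mxE.
  by case: eqP => [->|_]; rewrite ?mulr0n // mulVf // gt_eqF.
have E : W *m K = X *m diag_mx (\row_k s`_k) *m invmx X.
  by rewrite -[K](mulmxK Xunit) XE !mulmxA Wm mul1mx.
have := congr1 mxtrace E.
rewrite [RHS]mxtrace_mulC mulmxA mulVmx // mul1mx mxtrace_diag.
under [in RHS]eq_bigr do rewrite mxE.
move=> <-; apply: eq_bigr => i _; rewrite mul_diag_mx !mxE mulrC //.
Qed.

(** For an eigenvector x, x^T K x = s_k x^T M x, with x^T M x > 0. *)
Lemma ordered_gen_eigenvalues_ge0 (R : realType) (n : nat) (K : 'M[R]_n)
    (m : 'rV[R]_n) (s : seq R) :
  (forall i, 0 < m 0 i) -> (forall x : 'cV[R]_n, 0 <= (x^T *m K *m x) 0 0) ->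
  ordered_gen_eigenvalues K (diag_mx m) s ->
  forall k : 'I_n, 0 <= s`_k.
Proof.
move=> m_gt0 K_ge0 [_ _ [X Xunit XE]] k.
have x_neq0 : col k X != 0.
  apply: contraTneq Xunit => Xk0; rewrite -unitmx_tr unitmxE.
  rewrite (expand_det_row _ k) big1 ?unitr0 // => j _.
  by have /matrixP/(_ j 0) := Xk0; rewrite !mxE => ->; rewrite mul0r.
have := K_ge0 (col k X); rewrite -mulmxA XE -scalemxAr mxE pmulr_lge0 //.
have -> : ((col k X)^T *m (diag_mx m *m col k X)) 0 0 = \sum_i m 0 i * X i k ^+ 2.
  rewrite !mxE; apply: eq_bigr => i _; rewrite mul_diag_mx !mxE expr2.
  by rewrite mulrCA.
have [i Xi] : exists i, X i k != 0.
  apply/existsP; apply: contraNT x_neq0; rewrite negb_exists => /forallP X0.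
  by apply/eqP/matrixP => i j; rewrite !mxE; apply/eqP; have := X0 i; rewrite negbK.
rewrite (bigD1 i) //= ltr_wpDr //; last by rewrite mulr_gt0 ?exprn_even_gt0.
by apply: sumr_ge0 => j _; rewrite mulr_ge0 ?sqr_ge0 // ltW.
Qed.

Lemma min_diag_ratio_le (R : realType) (n : nat) (K M : 'M[R]_n) (i : 'I_n) :
  min_diag_ratio K M <= K i i / M i i.
Proof.
rewrite /min_diag_ratio; apply: (@ge_bigmin_seq _ _ _ _ _ (K i i / M i i) _ id) => //.
by apply: map_f; rewrite mem_enum.
Qed.

(** For [0 < n] the starting value of the iterated minimum is itself a diagonal ratio, not the
    default 0. *)
Lemma le_min_diag_ratio (R : realType) (n : nat) (K M : 'M[R]_n) (c : R) :
  (0 < n)%N -> (forall i, c <= K i i / M i i) -> c <= min_diag_ratio K M.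
Proof.
move=> n0 hc; rewrite /min_diag_ratio; set s := image_mem _ _.
have hs r : r \in s -> c <= r by case/mapP => i _ ->.
rewrite big_seq; apply: le_bigmin => [|r]; last exact: hs.
have : (0 < size s)%N by rewrite size_image card_ord.
by case: s hs => //= r s hs _; apply: hs; rewrite mem_head.
Qed.

Lemma top_gen_eigenvalue_le (R : realType) (n : nat) (K : 'M[R]_n) (m : 'rV[R]_n)
    (s : seq R) :
  (0 < n)%N -> (forall i, 0 < m 0 i) ->
  (forall x : 'cV[R]_n, 0 <= (x^T *m K *m x) 0 0) ->
  ordered_gen_eigenvalues K (diag_mx m) s ->
  s`_n.-1 <= \sum_i K i i / m 0 i.
Proof.
move=> n0 m0 K0 hs; rewrite -(ordered_gen_eigenvalues_sum m0 hs).
have ln : (n.-1 < n)%N by rewrite prednK.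
rewrite (bigD1 (Ordinal ln)) //= lerDl; apply: sumr_ge0 => k _.
exact: ordered_gen_eigenvalues_ge0 m0 K0 hs k.
Qed.

(** One ratio is at most their sum, the others being nonnegative, and the sum of the eigenvalues is
    at most [n] times the last. *)
Lemma top_gen_eigenvalue_ge (R : realType) (n : nat) (K : 'M[R]_n) (m : 'rV[R]_n)
    (s : seq R) (i : 'I_n) :
  (forall i, 0 < m 0 i) -> (forall i, 0 <= K i i) ->
  ordered_gen_eigenvalues K (diag_mx m) s ->
  K i i / m 0 i <= n%:R * s`_n.-1.
Proof.
move=> m0 K0 hs; have [sz ss _] := hs.
apply: (@le_trans _ _ (\sum_i K i i / m 0 i)).
  rewrite (bigD1 i) //= lerDl; apply: sumr_ge0 => k _.
  by rewrite divr_ge0 // ltW.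
rewrite -(ordered_gen_eigenvalues_sum m0 hs) mulrC -[n in n%:R]card_ord mulr_natr.
rewrite -sumr_const; apply: ler_sum => k _.
have := ltn_ord k; case: n k i {K m m0 K0 hs} sz => // n k i sz kn.
by apply: le_sorted_leq_nth; rewrite ?inE ?sz.
Qed.

(** * B-splines near their first knot *)

(** The product rule applied to each term of the Cox-de Boor recursion. At the knots this is a
    conventional value. *)
Fixpoint dbspline (R : realType) (xi : seq R) (p i : nat) (x : R) : R :=
  match p with
  | 0 => 0
  | q.+1 =>
      ((xi`_(i + q.+1) - xi`_i)^-1 * bspline xi q i x +
       (x - xi`_i) / (xi`_(i + q.+1) - xi`_i) * dbspline xi q i x) +
      (- (xi`_(i + q.+2) - xi`_i.+1)^-1 * bspline xi q i.+1 x +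
       (xi`_(i + q.+2) - x) / (xi`_(i + q.+2) - xi`_i.+1) *
         dbspline xi q i.+1 x)
  end.

(* The polynomial that agrees with the spline on the knot span [xi_s, xi_(s+1)). *)
Fixpoint span_poly (R : realType) (xi : seq R) (s p i : nat) : {poly R} :=
  match p with
  | 0 => (i == s)%:R
  | q.+1 =>
      (xi`_(i + q.+1) - xi`_i)^-1 *: (('X - (xi`_i)%:P) * span_poly xi s q i) +
      (xi`_(i + q.+2) - xi`_i.+1)^-1 *:
        (((xi`_(i + q.+2))%:P - 'X) * span_poly xi s q i.+1)
  end.

Lemma sorted_nth_le (R : realType) (xi : seq R) (i j : nat) :
  sorted <=%R xi -> (i <= j)%N -> (j < size xi)%N -> xi`_i <= xi`_j.
Proof.
move=> sxi ij jn; apply: le_sorted_leq_nth => //.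
by rewrite inE (leq_ltn_trans ij).
Qed.

Lemma bspline_out (R : realType) (xi : seq R) (p i : nat) (x : R) :
  sorted <=%R xi -> (i + p.+1 < size xi)%N ->
  (x < xi`_i) || (xi`_(i + p.+1) <= x) ->
  bspline xi p i x = 0 /\ dbspline xi p i x = 0.
Proof.
move=> sxi; elim: p i => [|q IH] i hi /= out.
  by rewrite addn1 in out; case: ifP => // ?; split => //; lra.
have h1 : xi`_i <= xi`_i.+1 by apply: sorted_nth_le => //; lia.
have h2 : xi`_(i + q.+1) <= xi`_(i + q.+2) by apply: sorted_nth_le => //; lia.
have [||-> ->] := IH i; [lia| by lra |].
have [||-> ->] := IH i.+1; [lia| by rewrite addSnnS; lra |].
by rewrite !mulr0 !addr0.
Qed.

(** A weight of the recursion is negative only where the spline it multiplies vanishes. *)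
Lemma bspline_ge0 (R : realType) (xi : seq R) (p i : nat) (x : R) :
  sorted <=%R xi -> (i + p.+1 < size xi)%N -> 0 <= bspline xi p i x.
Proof.
move=> sxi; elim: p i => [|q IH] i hi /=; first by case: ifP.
apply: addr_ge0.
  case: (boolP ((x < xi`_i) || (xi`_(i + q.+1) <= x))) => out.
    by have [|-> _] := bspline_out sxi _ out; [lia | rewrite mulr0].
  by rewrite mulr_ge0 ?IH //; [rewrite divr_ge0 //; lra | lia].
case: (boolP ((x < xi`_i.+1) || (xi`_(i.+1 + q.+1) <= x))) => out.
  by have [|-> _] := bspline_out sxi _ out; [lia | rewrite mulr0].
rewrite addSnnS in out.
by rewrite mulr_ge0 ?IH //; [rewrite divr_ge0 //; lra | lia].
Qed.

Lemma bspline_span (R : realType) (xi : seq R) (s p i : nat) (x : R) :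
  sorted <=%R xi -> (s.+1 < size xi)%N -> (i + p.+1 < size xi)%N ->
  xi`_s <= x < xi`_s.+1 ->
  bspline xi p i x = (span_poly xi s p i).[x] /\
  dbspline xi p i x = ((span_poly xi s p i)^`()).[x].
Proof.
move=> sxi hs; elim: p i => [|q IH] i hi xs /=.
  rewrite (_ : (_ <= _ < _) = (i == s)).
    by case: eqP => _; rewrite ?derivC ?hornerC // -polyC1 derivC !hornerC.
  case: (ltngtP i s) => [lt_is|lt_si|->]; last by [].
  - have : xi`_i.+1 <= xi`_s by apply: sorted_nth_le => //; lia.
    by lra.
  - have : xi`_s.+1 <= xi`_i by apply: sorted_nth_le => //; lia.
    by lra.
have [||-> ->] := IH i; [lia|by []|].
have [||-> ->] := IH i.+1; [lia|by []|].
have hE := (hornerD, hornerN, hornerZ, hornerM, hornerX, hornerC).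
split; rewrite ?(derivD, derivN, derivZ, derivM, derivX, derivC) !hE; ring.
Qed.

Lemma span_poly_eq0 (R : realType) (xi : seq R) (s p i : nat) :
  (s < i)%N || (i + p < s)%N -> span_poly xi s p i = 0.
Proof.
elim: p i => [|q IH] i /= h; first by case: eqP => //; lia.
by rewrite !IH ?mulr0 ?scaler0 ?addr0 //; lia.
Qed.

(* To the right of a knot of which it contains s - i + 1 copies, the spline of
   index i starts like a positive multiple of the power i + p - s. *)
Lemma span_poly_factor (R : realType) (xi : seq R) (s p i : nat) :
  sorted <=%R xi -> (i + p.+1 < size xi)%N -> (i <= s <= i + p)%N ->
  xi`_i = xi`_s -> xi`_s < xi`_s.+1 ->
  exists2 Q : {poly R}, 0 < Q.[xi`_s] &
    span_poly xi s p i = ('X - (xi`_s)%:P) ^+ (i + p - s) * Q.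
Proof.
move=> sxi; elim: p i => [|q IH] i hi his eq_is lt_s.
  exists 1; first by rewrite hornerC.
  have -> : i = s by lia.
  by rewrite /= eqxx addn0 subnn expr0 mul1r.
have le_is : (i <= s)%N by lia.
have lt_q : xi`_s < xi`_(i + q.+2).
  apply: (lt_le_trans lt_s); apply: sorted_nth_le => //; lia.
have [eqsi|lt_i] : s = i \/ (i < s)%N by lia.
  have [||||Q Q0 QE] := IH i; [lia|lia|by []|by []|].
  exists ((xi`_(i + q.+1) - xi`_i)^-1 *: Q).
    rewrite hornerZ mulr_gt0 // invr_gt0 subr_gt0 eq_is.
    apply: (lt_le_trans lt_s); apply: sorted_nth_le => //; lia.
  rewrite /= (@span_poly_eq0 _ _ s q i.+1) ?mulr0 ?scaler0 ?addr0; last by lia.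
  rewrite QE eq_is (_ : (i + q.+1 - s = (i + q - s).+1)%N) ?exprS; last by lia.
  by rewrite -scalerAr mulrA.
have eq_is1 : xi`_i.+1 = xi`_s.
  apply/le_anti/andP; split; first by apply: sorted_nth_le => //; lia.
  by rewrite -eq_is; apply: sorted_nth_le => //; lia.
have [||||Q2 Q20 Q2E] := IH i.+1; [lia|lia|by []|by []|].
(* The first term gains its missing factor from X - xi_i = X - xi_s, and it vanishes when s = i + q
   + 1. Nonnegativity of [Q1] suffices, since the second term contributes a positive value at
   xi_s. *)
have [Q1 Q10 Q1E] : exists2 Q1 : {poly R}, 0 <= Q1.[xi`_s] &
    (xi`_(i + q.+1) - xi`_i)^-1 *: (('X - (xi`_i)%:P) * span_poly xi s q i) =
    ('X - (xi`_s)%:P) ^+ (i + q.+1 - s) * Q1.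
  have [le_s|gt_s] : (s <= i + q)%N \/ (i + q < s)%N by lia.
    have [||||Q Q0 QE] := IH i; [lia|lia|by []|by []|].
    exists ((xi`_(i + q.+1) - xi`_i)^-1 *: Q).
      rewrite hornerZ mulr_ge0 ?(ltW Q0) // invr_ge0 subr_ge0.
      by apply: sorted_nth_le => //; lia.
    rewrite QE eq_is (_ : (i + q.+1 - s = (i + q - s).+1)%N) ?exprS; last by lia.
    by rewrite -scalerAr mulrA.
  exists 0; first by rewrite hornerC.
  by rewrite span_poly_eq0 ?mulr0 ?scaler0 //; lia.
exists (Q1 + (xi`_(i + q.+2) - xi`_i.+1)^-1 *: (((xi`_(i + q.+2))%:P - 'X) * Q2)).
  rewrite !(hornerD, hornerN, hornerZ, hornerM, hornerX, hornerC).
  rewrite ltr_wpDl // mulr_gt0 //.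
    by rewrite invr_gt0 eq_is1 subr_gt0.
  by rewrite mulr_gt0 // subr_gt0.
rewrite [LHS]/= Q1E Q2E mulrDr (_ : (i.+1 + q - s = i + q.+1 - s)%N); last by lia.
by rewrite -scalerAr mulrCA.
Qed.

(** For q > 0 the derivative of (x - a)^q Q is (x - a)^(q-1) times a cofactor with value q Q(a) at
    a; by continuity Q and this cofactor stay close to their values at a. For q = 0 the exponent
    [q.-1] is 0 and the derivative of Q is bounded directly. *)
Lemma poly_near_root (R : realType) (a : R) (q : nat) (Q : {poly R}) :
  0 < Q.[a] ->
  exists e c C : R, [/\ 0 < e, 0 < c & 0 < C] /\
    forall x, a <= x < a + e -> let P := ('X - a%:P) ^+ q * Q in
      [/\ c * (x - a) ^+ q <= P.[x] <= C * (x - a) ^+ q,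
          `|P^`().[x]| <= C * (x - a) ^+ q.-1 &
          (q = 1)%N -> c <= P^`().[x]].
Proof.
move=> Qa; pose Q' := Q *+ q + ('X - a%:P) * Q^`().
have Q'a : Q'.[a] = Q.[a] *+ q.
  rewrite !(hornerD, hornerN, hornerM, hornerX, hornerC, hornerMn).
  by rewrite subrr mul0r addr0.
have h1 : \forall x \near a, Q.[a] / 2 < Q.[x] < 2 * Q.[a].
  have : Q.[x] @[x --> a] --> Q.[a] by exact: continuous_horner.
  move/cvgrPdist_lt => /(_ (Q.[a] / 2)); rewrite divr_gt0 // => /(_ isT).
  by apply: filterS => x; rewrite ltr_norml; lra.
have h2 : \forall x \near a, `|Q'.[a] - Q'.[x]| < Q.[a] / 2.
  have : Q'.[x] @[x --> a] --> Q'.[a] by exact: continuous_horner.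
  by move/cvgrPdist_lt => /(_ (Q.[a] / 2)); rewrite divr_gt0 // => /(_ isT).
have h3 : \forall x \near a, `|Q^`().[a] - Q^`().[x]| < 1.
  have : Q^`().[x] @[x --> a] --> Q^`().[a] by exact: continuous_horner.
  by move/cvgrPdist_lt => /(_ 1); rewrite ltr01 // => /(_ isT).
have [e /= e0 he] : nbhs a [set x | [/\ Q.[a] / 2 < Q.[x] < 2 * Q.[a],
    `|Q'.[a] - Q'.[x]| < Q.[a] / 2 & `|Q^`().[a] - Q^`().[x]| < 1]].
  by near=> x; split; near: x.
(* The first summand bounds P, the first two bound its derivative for q > 0, and the last two do so
   for q = 0. *)
pose C := 2 * Q.[a] + `|Q'.[a]| + `|Q^`().[a]| + 1.
exists e, (Q.[a] / 2), C.
have C0 : 0 < C by have := normr_ge0 Q'.[a]; have := normr_ge0 Q^`().[a]; rewrite /C; lra.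
split; first by split=> //; lra.
move=> x xa; set P := _ * Q.
have [hQ hQ' hdQ] : [/\ Q.[a] / 2 < Q.[x] < 2 * Q.[a],
    `|Q'.[a] - Q'.[x]| < Q.[a] / 2 & `|Q^`().[a] - Q^`().[x]| < 1].
  by apply: he; rewrite /ball /= ltr_norml; lra.
have xa0 : 0 <= x - a by lra.
have PE : P.[x] = (x - a) ^+ q * Q.[x] by rewrite hornerM horner_exp !hornerE.
have powq_ge0 k : 0 <= (x - a) ^+ k by rewrite exprn_ge0.
have dPE : P^`().[x] = (x - a) ^+ q.-1 * Q.[x] *+ q + (x - a) ^+ q * Q^`().[x].
  rewrite derivM deriv_exp derivXsubC mul1r hornerD !hornerM hornerMn.
  by rewrite !horner_exp !hornerE mulrnAl.
have dPE' : (0 < q)%N -> P^`().[x] = (x - a) ^+ q.-1 * Q'.[x].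
  move=> q0; have xq : (x - a) ^+ q = (x - a) ^+ q.-1 * (x - a).
    by rewrite -exprSr prednK.
  rewrite dPE xq /Q' hornerD hornerMn hornerM.
  by rewrite hornerD hornerX hornerN hornerC [RHS]mulrDr mulrnAr mulrA.
split.
- have := normr_ge0 Q'.[a]; have := normr_ge0 Q^`().[a].
  move: hQ => /andP[u1 u2] ? ?; rewrite PE [_ * Q.[x]]mulrC.
  by apply/andP; split; rewrite ler_wpM2r // /C; lra.
- have [q0|q0] := posnP q.
    rewrite dPE q0 mulr0n add0r expr0 mul1r mulr1.
    move: hdQ (normr_ge0 Q'.[a]); rewrite ltr_norml /C => /andP[u1 u2] u3.
    have /ler_normlP[v1 v2] := lexx `|Q^`().[a]|.
    by rewrite ler_norml; lra.
  rewrite dPE' // normrM [`|_ ^+ _|]ger0_norm // mulrC ler_wpM2r //.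
  move: hQ' (normr_ge0 Q^`().[a]); rewrite ltr_norml /C => /andP[u1 u2] u3.
  have /ler_normlP[v1 v2] := lexx `|Q'.[a]|.
  by rewrite ler_norml; lra.
- move=> q1; rewrite dPE' q1 // expr0 mul1r.
  by move: hQ'; rewrite Q'a q1 mulr1n ltr_norml; lra.
Unshelve. all: by end_near. Qed.

(** * Positions and multiplicities in an open knot vector, and the behaviour of a spline at its
    first knot *)

Lemma count_le_lt_mem (R : realType) (xi : seq R) (x : R) :
  count (<= x) xi = (count (< x) xi + count_mem x xi)%N.
Proof.
elim: xi => //= y xi ->; rewrite le_eqVlt.
by case: (ltgtP y x) => //= _; lia.
Qed.

Lemma count_le_sub_mult (R : realType) (xi : seq R) (i : nat) :
  sorted <=%R xi -> (i < size xi)%N ->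
  (count (<= xi`_i)%R xi <= i + count_mem (xi`_i)%R xi)%N.
Proof.
move=> sxi hi; rewrite count_le_lt_mem leq_add2r leqNgt; apply/negP => lt_i.
by have := nth_count_lt 0 sxi lt_i; rewrite ltxx.
Qed.

Lemma lt_count_le (R : realType) (xi : seq R) (i : nat) (x : R) :
  sorted <=%R xi -> (i < size xi)%N -> (i < count (<= x) xi)%N = (xi`_i <= x).
Proof.
move=> sxi hi; apply/idP/idP; first exact: nth_count_le.
apply: contraTT; rewrite -leqNgt -ltNge => le_i.
by apply: nth_count_gt; rewrite ?le_i.
Qed.

Lemma open_knot_vector_mult (R : realType) (p : nat) (xi : seq R) (x : R) :
  open_knot_vector p xi -> x \in xi -> (count_mem x xi <= p.+1)%N.
Proof.
move=> [sxi xi01 c0 c1 cm] x_xi; have := xi01 x x_xi => /andP[x0 x1].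
have [->|xn0] := eqVneq x 0; first by rewrite c0.
have [->|xn1] := eqVneq x 1; first by rewrite c1.
have /andP[_] : (1 <= count_mem x xi <= p)%N.
  by apply: cm => //; rewrite !lt_neqAle x0 x1 xn1 eq_sym xn0.
by move/leqW.
Qed.

Lemma count_lt1 (R : realType) (p : nat) (xi : seq R) :
  open_knot_vector p xi -> count (< 1) xi = n_bsplines p xi.
Proof.
move=> [sxi xi01 c0 c1 cm].
have : count (<= 1) xi = size xi.
  apply/eqP; rewrite -all_count; apply/allP => x /xi01.
  by case/andP.
by rewrite count_le_lt_mem c1 /n_bsplines => <-; rewrite addnK.
Qed.

(** In a sorted list the entries at most xi_i fill an initial segment, so [s] is the last position
    of this knot; a multiplicity of at most p + 1 gives s <= i + p. *)
Lemma last_occurrence (R : realType) (p : nat) (xi : seq R) (i : nat) :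
  open_knot_vector p xi -> (i < n_bsplines p xi)%N ->
  let s := (count (<= xi`_i) xi).-1 in
  [/\ (s.+1 < size xi)%N, (i <= s <= i + p)%N, xi`_i = xi`_s & xi`_s < xi`_s.+1].
Proof.
move=> hxi hi; have c1 := count_lt1 hxi.
have [sxi xi01 _ _ _] := hxi.
have hsz : (i + p.+1 < size xi)%N by move: hi; rewrite /n_bsplines; lia.
have isz : (i < size xi)%N by lia.
have lt1 : xi`_i < 1 by apply: (nth_count_lt 0 sxi); rewrite c1.
set c := count _ _ => s.
have ic : (i < c)%N by rewrite lt_count_le.
have sc : c = s.+1 by rewrite /s; lia.
have csz : (c <= i + p.+1)%N.
  apply: leq_trans (count_le_sub_mult sxi isz) _; rewrite leq_add2l.
  by apply: open_knot_vector_mult => //; exact: mem_nth.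
have h : xi`_s <= xi`_i by rewrite -lt_count_le // -/c; lia.
have h' : xi`_i < xi`_s.+1.
  by rewrite ltNge -lt_count_le -/c; lia.
have e : xi`_i = xi`_s.
  by apply/le_anti; rewrite h sorted_nth_le //; lia.
by split; [lia|lia|by []|by rewrite -e].
Qed.

(* The exponent [i + p - s] of [span_poly_factor], s being the last index at which
   the knot xi_i occurs. *)
Definition start_order (R : realType) (p : nat) (xi : seq R) (i : nat) : nat :=
  (i + p.+1 - count (<= xi`_i)%R xi)%N.

Lemma bspline_near_start (R : realType) (p : nat) (xi : seq R) (i : nat) :
  open_knot_vector p xi -> (i < n_bsplines p xi)%N ->
  let q := start_order p xi i in let a := xi`_i in
  exists e c C : R, [/\ 0 < e, 0 < c & 0 < C] /\
    forall x, a <= x < a + e ->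
      [/\ c * (x - a) ^+ q <= bspline xi p i x <= C * (x - a) ^+ q,
          `|dbspline xi p i x| <= C * (x - a) ^+ q.-1 &
          (q = 1)%N -> c <= dbspline xi p i x].
Proof.
move=> hxi hi q a; have [sxi _ _ _ _] := hxi.
have hsz : (i + p.+1 < size xi)%N by move: hi; rewrite /n_bsplines; lia.
have := last_occurrence hxi hi; set s := _.-1 => -[ssz his eq_is lt_s].
have [Q Q0 QE] := span_poly_factor sxi hsz his eq_is lt_s.
have ic : (i < count (<= xi`_i)%R xi)%N by rewrite lt_count_le //; lia.
have qE : q = (i + p - s)%N by rewrite /q /start_order /s; lia.
rewrite -qE -eq_is -/a in Q0 QE.
have [e [c [C [[e0 c0 C0] hP]]]] := poly_near_root q Q0.
(* The polynomial represents the spline only up to the next knot. *)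
exists (Num.min e (xi`_s.+1 - xi`_s)), c, C; split.
  by split=> //; rewrite lt_min e0 subr_gt0.
move=> x; rewrite -ltrBlDl lt_min => /andP[ax /andP[xe xs]].
have [|-> ->] := @bspline_span _ _ s p i x sxi ssz hsz.
  by rewrite -eq_is -/a ax; move: xs; rewrite -eq_is -/a; lra.
by rewrite QE; apply: hP; rewrite ax -ltrBlDl.
Qed.

(** * Boundedness, measurability and differentiability of the splines *)

Lemma bspline_bounded (R : realType) (xi : seq R) (p i : nat) :
  exists2 C : R, 0 < C &
    forall x, 0 <= x <= 1 -> `|bspline xi p i x| <= C /\ `|dbspline xi p i x| <= C.
Proof.
elim: p i => [|q IH] i /=.
  by exists 1 => // x _; case: ifP => _; rewrite ?normr1 ?normr0.
have [C C0 hC] := IH i; have [D D0 hD] := IH i.+1.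
have lin (y a b : R) : `|y| <= `|a| + 1 -> `|y / b| <= (`|a| + 1) / `|b|.
  by move=> h; rewrite normrM normfV ler_wpM2r // invr_ge0.
have mul (y z Y Z : R) : `|y| <= Y -> `|z| <= Z -> `|y * z| <= Y * Z.
  by move=> hy hz; rewrite normrM ler_pM.
pose a := xi`_i; pose b := xi`_(i + q.+1) - a.
pose a' := xi`_(i + q.+2); pose b' := a' - xi`_i.+1.
(* The four summands bound the four terms of [dbspline]; the second and the fourth bound those of
   [bspline]. Adding 1 makes the constant positive. *)
pose E := `|b^-1| * C + (`|a| + 1) / `|b| * C + `|- b'^-1| * D + (`|a'| + 1) / `|b'| * D.
have t1 : 0 <= `|b^-1| * C by rewrite mulr_ge0 // ltW.
have t2 : 0 <= `|- b'^-1| * D by rewrite mulr_ge0 // ltW.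
have t3 : 0 <= (`|a| + 1) / `|b| * C by rewrite mulr_ge0 ?divr_ge0 ?addr_ge0 // ltW.
have t4 : 0 <= (`|a'| + 1) / `|b'| * D by rewrite mulr_ge0 ?divr_ge0 ?addr_ge0 // ltW.
exists (E + 1); first by rewrite /E; lra.
move=> x x01; have [C1 C2] := hC x x01; have [D1 D2] := hD x x01.
have x1 : `|x| <= 1 by rewrite ler_norml; lra.
have l1 : `|(x - a) / b| <= (`|a| + 1) / `|b|.
  by apply: lin; apply: le_trans (ler_normB _ _) _; lra.
have l2 : `|(a' - x) / b'| <= (`|a'| + 1) / `|b'|.
  by apply: lin; apply: le_trans (ler_normB _ _) _; lra.
split.
  apply: le_trans (ler_normD _ _) _.
  have := mul _ _ _ _ l1 C1; have := mul _ _ _ _ l2 D1.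
  by rewrite /E; lra.
apply: le_trans (ler_normD _ _) _.
have := mul _ _ _ _ l1 C2; have := mul _ _ _ _ l2 D2.
have := mul _ _ _ _ (lexx `|b^-1|) C1; have := mul _ _ _ _ (lexx `|- b'^-1|) D1.
have := ler_normD (b^-1 * bspline xi q i x) ((x - a) / b * dbspline xi q i x).
have := ler_normD (- b'^-1 * bspline xi q i.+1 x) ((a' - x) / b' * dbspline xi q i.+1 x).
by rewrite /E; lra.
Qed.

Lemma measurable_bspline (R : realType) (xi : seq R) (p i : nat) :
  measurable_fun setT (bspline xi p i).
Proof.
elim: p i => [|q IH] i /=.
  have -> : (fun x : R => if xi`_i <= x < xi`_i.+1 then 1 else 0 : R) =
      \1_(`[xi`_i, xi`_i.+1[%classic : set R).
    by apply/funext => x; rewrite indicE mem_setE in_itv /=; case: ifP.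
  exact: measurable_indic.
apply: measurable_funD; apply: measurable_funM => //; apply: measurable_funM => //.
  exact: measurable_funB.
exact: measurable_funB.
Qed.

Lemma measurable_dbspline (R : realType) (xi : seq R) (p i : nat) :
  measurable_fun setT (dbspline xi p i).
Proof.
elim: p i => [|q IH] i /=; first exact: measurable_cst.
by apply: measurable_funD; apply: measurable_funD; apply: measurable_funM => //;
  do ?[exact: measurable_bspline]; apply: measurable_funM => //;
  exact: measurable_funB.
Qed.

(** Off the knots, comparisons with knots are locally constant, which settles degree 0; the product
    rule does the rest. *)
Lemma is_derive_bspline (R : realType) (xi : seq R) (p i : nat) (x : R) :
  x \notin xi -> (i + p.+1 < size xi)%N ->
  is_derive x 1 (bspline xi p i) (dbspline xi p i x).
Proof.
move=> x_xi; elim: p i => [|q IH] i hi /=.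
  have hn j : (j < size xi)%N -> xi`_j != x.
    by move=> hj; apply: contraNneq x_xi => <-; exact: mem_nth.
  have hle a : a != x -> \forall y \near x, (a <= y) = (a <= x).
    rewrite neq_lt => /orP[ax|xa].
      by apply: filterS (lt_nbhsr ax) => y ay; rewrite !ltW.
    by apply: filterS (lt_nbhsl xa) => y ya; rewrite !leNgt ya xa.
  apply: (@near_eq_is_derive _ _ _ (cst (bspline xi 0 i x))).
    have := hle _ (hn i ltac:(lia)); have := hle _ (hn i.+1 ltac:(lia)).
    by apply: filterS2 => y e1 e2; rewrite /= e2 !ltNge e1.
have d1 := IH i ltac:(lia); have d2 := IH i.+1 ltac:(lia).
have d3 a b : is_derive x 1 (fun y : R => (y - a) / b) b^-1.
  have -> : (fun y : R => (y - a) / b) = b^-1 \*: (id - cst a).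
    by apply/funext => y /=; rewrite mulrC.
  by apply: is_derive_eq; rewrite subr0 /GRing.scale /= mulr1.
have d4 a b : is_derive x 1 (fun y : R => (a - y) / b) (- b^-1).
  have -> : (fun y : R => (a - y) / b) = b^-1 \*: (cst a - id).
    by apply/funext => y /=; rewrite mulrC.
  by apply: is_derive_eq; rewrite sub0r /GRing.scale /= mulrN1.
have := is_deriveD (is_deriveM (d3 xi`_i (xi`_(i + q.+1) - xi`_i)) d1)
   (is_deriveM (d4 xi`_(i + q.+2) (xi`_(i + q.+2) - xi`_i.+1)) d2).
move/is_derive_eq; apply.
rewrite /GRing.scale /=. ring.
Qed.

(** * Integrals over the trimmed domain *)

Local Notation mu := (@lebesgue_measure _).

(** The exceptional set is finite, hence null. Measurability of [f] is derived from that of [g], as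
    preimages differ only by points of [s]: in the application [f] is a product of pointwise
    derivatives. *)
Lemma Rintegral_eq_off_seq (R : realType) (D : set R) (f g : R -> R) (s : seq R) :
  measurable D -> measurable_fun D g ->
  (forall x, D x -> x \notin s -> f x = g x) ->
  \int[mu]_(x in D) f x = \int[mu]_(x in D) g x.
Proof.
move=> mD mg fg.
have countS (A : set R) : countable (A `&` [set` s]).
  apply: sub_countable (finite_set_countable (finite_seq s)).
  by apply: subset_card_le; apply: subIsetr.
have mf : measurable_fun D f.
  move=> _ Y mY.
  have -> : D `&` f @^-1` Y =
      ((D `&` g @^-1` Y) `\` [set` s]) `|` ((D `&` f @^-1` Y) `&` [set` s]).
    apply/seteqP; split=> x /=.
      move=> [Dx fY]; have [xs|xs] := boolP (x \in s); [by right|left].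
      by rewrite -fg //; split=> //; apply/negP.
    move=> [[[Dx gY] /negP xs]|[[]]] //.
    by rewrite fg.
  apply: measurableU; last by apply: countable_measurable => // x; exact: measurable_set1.
  apply: measurableD; first exact: mg.
  apply: countable_measurable => [x|]; first exact: measurable_set1.
  exact: finite_set_countable (finite_seq s).
congr fine; apply: ae_eq_integral => //; try exact/measurable_EFinP.
exists (D `&` [set` s]); split.
- by apply: countable_measurable => // x; exact: measurable_set1.
- exact: countable_lebesgue_measure0.
- move=> x /= h; apply: contrapT => nx; apply: h => Dx; rewrite fg //.
  by apply/negP => xs; apply: nx.
Qed.

Lemma lebesgue_measure_oo (R : realType) (a b : R) : a <= b ->
  fine (mu (`]a, b[%classic : set R)) = b - a.
Proof.
move=> ab; rewrite lebesgue_measure_itv /= lte_fin; case: ltP => // ba.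
have -> : a = b by apply/le_anti; rewrite ab ba.
by rewrite subrr.
Qed.

Lemma integrable_itv_cst (R : realType) (T c : R) (A : set R) : measurable A ->
  mu.-integrable (`]0, T[%classic : set R) (EFin \o ((fun=> c) \_ A)).
Proof.
move=> mA; apply: measurable_bounded_integrable => //.
- by rewrite /= lebesgue_measure_itv /=; case: ifP; rewrite ltry.
- by apply/measurable_restrict => //; exact: measurableI.
- exists `|c|; split; first exact: num_real.
  move=> M cM x _ /=; rewrite patchE; case: ifP => _; first exact: ltW.
  by rewrite normr0 ltW // (le_lt_trans _ cM).
Qed.

(** Comparison with the function equal to [C] on [a, T[ and to 0 elsewhere. When [a] is the first
    knot of a spline, T - a is the length of the piece left by the trimming. *)
Lemma le_Rintegral_cst_tail (R : realType) (T a C : R) (f : R -> R) :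
  mu.-integrable (`]0, T[%classic : set R) (EFin \o f) ->
  0 <= a <= T -> 0 <= C -> (forall x, 0 < x < T -> x < a -> f x <= 0) ->
  (forall x, 0 < x < T -> a <= x -> f x <= C) ->
  \int[mu]_(x in `]0, T[) f x <= C * (T - a).
Proof.
move=> intf a0T C0 f0 fC.
have intT : \int[mu]_(x in `]0, T[) ((fun=> C) \_ (`[a, T[ : set R)) x <= C * (T - a).
  rewrite -Rintegral_mkcondr Rintegral_cst; last exact: measurableI.
  rewrite ler_wpM2l //.
  have -> : T - a = fine (mu (`[a, T[%classic : set R)).
    rewrite lebesgue_measure_itv /= lte_fin; case: ltP => // ba.
    have -> : a = T by lra.
    by rewrite subrr.
  rewrite fine_le //.
  - rewrite ge0_fin_numE //.
    apply: (@le_lt_trans _ _ (mu (`]0, T[%classic : set R))).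
      apply: le_measure; rewrite ?inE //=; first [exact: measurableI|exact: subIsetl].
    by rewrite lebesgue_measure_itv /=; case: ifP; rewrite ltry.
  - by rewrite lebesgue_measure_itv /=; case: ifP.
  - apply: le_measure; rewrite ?inE //=; first [exact: measurableI|exact: subIsetr].
apply: le_trans intT; apply: le_Rintegral => //; first exact: integrable_itv_cst.
move=> x /=; rewrite in_itv /= patchE mem_setE in_itv /= => x0T.
have [ax|xa] := leP a x; last exact: f0.
by case/andP: (x0T) => _ ->; exact: fC.
Qed.

Lemma ge_Rintegral_cst_sub (R : realType) (T u v c : R) (f : R -> R) :
  mu.-integrable (`]0, T[%classic : set R) (EFin \o f) ->
  0 <= u <= v -> v <= T -> (forall x, 0 < x < T -> 0 <= f x) ->
  (forall x, u < x < v -> c <= f x) ->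
  c * (v - u) <= \int[mu]_(x in `]0, T[) f x.
Proof.
move=> intf u0v vT f0 fc.
have <- : \int[mu]_(x in `]0, T[) ((fun=> c) \_ (`]u, v[ : set R)) x = c * (v - u).
  rewrite -Rintegral_mkcondr Rintegral_cst; last exact: measurableI.
  rewrite (_ : _ `&` _ = (`]u, v[%classic : set R)); last first.
    by apply/seteqP; split=> x /=; rewrite !in_itv /=; lra.
  by rewrite lebesgue_measure_oo //; lra.
apply: le_Rintegral => //; first exact: integrable_itv_cst.
move=> x /=; rewrite in_itv /= patchE mem_setE in_itv /= => x0T.
by case: ifP => [/fc|] // _; exact: f0.
Qed.

Lemma Rintegral_sum (d : measure_display) (T : measurableType d) (R : realType)
    (m : {measure set T -> \bar R}) (D : set T) (I : Type) (r : seq I)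
    (f : I -> T -> R) :
  measurable D -> (forall i, m.-integrable D (EFin \o f i)) ->
  m.-integrable D (EFin \o (fun x => \sum_(i <- r) f i x)) /\
  \int[m]_(x in D) (\sum_(i <- r) f i x) = \sum_(i <- r) \int[m]_(x in D) f i x.
Proof.
move=> mD intf; elim: r => [|i r [intr IH]].
  have -> : (fun x => \sum_(i <- [::]) f i x) = cst 0.
    by apply/funext => x; rewrite big_nil.
  rewrite big_nil; split; last by rewrite Rintegral_cst // mul0r.
  exact: integrable0.
have -> : (fun x => \sum_(k <- i :: r) f k x) = (fun x => f i x + \sum_(k <- r) f k x).
  by apply/funext => x; rewrite big_cons.
rewrite big_cons RintegralD // IH; split=> //.
exact: (integrableD mD (intf i) intr).
Qed.

Lemma integrable_EFinZl (d : measure_display) (T : measurableType d) (R : realType)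
    (m : {measure set T -> \bar R}) (D : set T) (c : R) (f : T -> R) :
  measurable D -> m.-integrable D (EFin \o f) ->
  m.-integrable D (EFin \o (fun x => c * f x)).
Proof. by move=> mD intf; exact: (integrableZl mD c intf). Qed.

(** Together with [mass], a diagonal matrix entry indexed by position in the whole knot vector, so
    that one spline can be followed while [T] varies. *)
Definition energy (R : realType) (p : nat) (xi : seq R) (T : R) (i : nat) : R :=
  \int[mu]_(x in trimmed_domain T) dbspline xi p i x ^+ 2.

Definition mass (R : realType) (p : nat) (xi : seq R) (T : R) (i : nat) : R :=
  \int[mu]_(x in trimmed_domain T) bspline xi p i x.

Lemma integrable_bounded01 (R : realType) (T C : R) (f : R -> R) :
  T <= 1 -> measurable_fun setT f -> (forall x, 0 <= x <= 1 -> `|f x| <= C) ->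
  mu.-integrable (trimmed_domain T) (EFin \o f).
Proof.
move=> T1 mf fC; rewrite /trimmed_domain; apply: measurable_bounded_integrable => //.
- by rewrite /= lebesgue_measure_itv /=; case: ifP; rewrite ltry.
- exact: measurable_funTS.
- exists C; split; first exact: num_real.
  move=> M CM x /=; rewrite in_itv /= => /andP[x0 xT].
  by apply: le_trans (ltW CM); apply: fC; lra.
Qed.

Lemma integrable_bspline (R : realType) (p : nat) (xi : seq R) (T : R) (i : nat) :
  T <= 1 -> mu.-integrable (trimmed_domain T) (EFin \o bspline xi p i).
Proof.
have [C _ hC] := bspline_bounded xi p i.
move=> T1; apply: (@integrable_bounded01 _ _ C) => //; first exact: measurable_bspline.
by move=> x /hC[].
Qed.

Lemma integrable_dbsplineM (R : realType) (p : nat) (xi : seq R) (T : R) (i j : nat) :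
  T <= 1 -> mu.-integrable (trimmed_domain T)
    (EFin \o (fun x => dbspline xi p i x * dbspline xi p j x)).
Proof.
have [C C0 hC] := bspline_bounded xi p i; have [D D0 hD] := bspline_bounded xi p j.
move=> T1; apply: (@integrable_bounded01 _ _ (C * D)) => //.
  by apply: measurable_funM; exact: measurable_dbspline.
move=> x x01; have [_ hc] := hC x x01; have [_ hd] := hD x x01.
by rewrite normrM ler_pM.
Qed.

Lemma integrable_dbspline_sqr (R : realType) (p : nat) (xi : seq R) (T : R) (i : nat) :
  T <= 1 -> mu.-integrable (trimmed_domain T)
    (EFin \o (fun x => dbspline xi p i x ^+ 2)).
Proof. by move=> T1; apply: integrable_dbsplineM. Qed.

Lemma stiffnessE (R : realType) (p : nat) (xi : seq R) (T : R)
    (i j : 'I_(n_active p xi T)) :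
  stiffness p xi T i j =
  \int[mu]_(x in trimmed_domain T)
    (dbspline xi p (enum_val i) x * dbspline xi p (enum_val j) x).
Proof.
have hsz (k : 'I_(n_bsplines p xi)) : (k + p.+1 < size xi)%N.
  by have := ltn_ord k; rewrite {2}/n_bsplines; lia.
rewrite mxE /trimmed_domain; apply: (@Rintegral_eq_off_seq _ _ _ _ xi) => //.
  apply: measurable_funTS.
  by apply: measurable_funM; exact: measurable_dbspline.
move=> x _ xxi; rewrite !derive1E.
by have [_ ->] := is_derive_bspline xxi (hsz (enum_val i));
   have [_ ->] := is_derive_bspline xxi (hsz (enum_val j)).
Qed.

Lemma stiffness_diag (R : realType) (p : nat) (xi : seq R) (T : R)
    (i : 'I_(n_active p xi T)) :
  stiffness p xi T i i = energy p xi T (enum_val i).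
Proof. by rewrite stiffnessE. Qed.

Lemma stiffness_sym (R : realType) (p : nat) (xi : seq R) (T : R) :
  (stiffness p xi T)^T = stiffness p xi T.
Proof.
apply/matrixP => i j; rewrite !mxE; apply: eq_Rintegral => x _.
by rewrite mulrC.
Qed.

(** The quadratic form is the integral of the square of sum_i x_i phi_i', expanded over pairs of
    indices. *)
Lemma stiffness_psd (R : realType) (p : nat) (xi : seq R) (T : R)
    (x : 'cV[R]_(n_active p xi T)) :
  T <= 1 -> 0 <= (x^T *m stiffness p xi T *m x) 0 0.
Proof.
move=> T1.
pose d (i : 'I_(n_active p xi T)) := dbspline xi p (enum_val i).
pose g (ij : 'I_(n_active p xi T) * 'I_(n_active p xi T)) (t : R) :=
  x ij.1 0 * x ij.2 0 * (d ij.1 t * d ij.2 t).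
have intg ij : mu.-integrable (trimmed_domain T) (EFin \o g ij).
  have h := @integrable_dbsplineM _ p xi T (enum_val ij.1) (enum_val ij.2) T1.
  by apply: integrable_EFinZl h; rewrite /trimmed_domain.
have -> : (x^T *m stiffness p xi T *m x) 0 0 =
    \sum_(ij <- index_enum _) \int[mu]_(t in trimmed_domain T) g ij t.
  rewrite -(pair_bigA _ (fun i j => \int[mu]_(t in trimmed_domain T) g (i, j) t)) /=.
  rewrite exchange_big mxE; apply: eq_bigr => j _.
  rewrite mxE mulr_suml; apply: eq_bigr => i _.
  rewrite [x^T 0 i]mxE stiffnessE /g /= RintegralZl.
  - by rewrite mulrAC.
  - by rewrite /trimmed_domain.
  - exact: integrable_dbsplineM.
have [|_ <-] := Rintegral_sum (index_enum _) _ intg; first by rewrite /trimmed_domain.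
apply: Rintegral_ge0 => t _.
rewrite (_ : \sum_(i <- _) _ = (\sum_i x i 0 * d i t) ^+ 2) ?sqr_ge0 //.
rewrite expr2 big_distrl /=.
under [RHS]eq_bigr do rewrite big_distrr /=.
rewrite pair_bigA /=; apply: eq_bigr => -[i j] _ /=.
by rewrite /g /= mulrACA.
Qed.

Lemma lumped_massE (R : realType) (p : nat) (xi : seq R) (T : R) :
  lumped_mass p xi T = diag_mx (\row_(i < n_active p xi T) mass p xi T (enum_val i)).
Proof. by []. Qed.

Lemma knot_index_size (R : realType) (p : nat) (xi : seq R) (i : nat) :
  (i < n_bsplines p xi)%N -> (i + p.+1 < size xi)%N.
Proof. by rewrite /n_bsplines; lia. Qed.

Lemma open_knot_ge0 (R : realType) (p : nat) (xi : seq R) (i : nat) :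
  open_knot_vector p xi -> (i < n_bsplines p xi)%N -> 0 <= xi`_i.
Proof.
move=> [_ xi01 _ _ _] /knot_index_size hi.
have isz : (i < size xi)%N by lia.
by have /andP[] := xi01 _ (mem_nth 0 isz).
Qed.

(** * Energy and mass of a single spline as the trimming varies *)

Lemma energy_ge0 (R : realType) (p : nat) (xi : seq R) (T : R) (i : nat) :
  0 <= energy p xi T i.
Proof. by apply: Rintegral_ge0 => x _; exact: sqr_ge0. Qed.

(** On the right half of [xi_i, xi_i + w] the spline is at least c (w/2)^q. The width [w] is kept
    apart from [T]: it is [delta] for a spline starting at xi_l, and fixed for one starting
    earlier. *)
Lemma mass_ge (R : realType) (p : nat) (xi : seq R) (i : nat) :
  open_knot_vector p xi -> (i < n_bsplines p xi)%N ->
  exists e c : R, [/\ 0 < e, 0 < c &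
    forall w T, 0 < w < e -> xi`_i + w <= T -> T <= 1 ->
      c * w ^+ (start_order p xi i).+1 <= mass p xi T i].
Proof.
move=> hxi hi; have a0 := open_knot_ge0 hxi hi.
have [e [c [C [[e0 c0 C0] hB]]]] := bspline_near_start hxi hi.
set q := start_order p xi i in hB *; set a := xi`_i in a0 hB *.
have q2 : 0 < (1 / 2 : R) ^+ q.+1 by rewrite exprn_gt0; lra.
exists e, (c * (1 / 2) ^+ q.+1); split=> //; first exact: mulr_gt0.
move=> w T we awT T1.
have : c * (w / 2) ^+ q * ((a + w) - (a + w / 2)) <= mass p xi T i.
  apply: ge_Rintegral_cst_sub; [exact: integrable_bspline|lra|lra| |].
    by move=> x _; apply: bspline_ge0; [case: hxi|exact: knot_index_size].
  move=> x xw; have [|/andP[+ _] _ _] := hB x; first lra.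
  apply: le_trans; rewrite ler_wpM2l ?(ltW c0) // lerXn2r ?nnegrE; lra.
apply: le_trans; rewrite le_eqVlt; apply/orP; left; apply/eqP.
have -> : a + w - (a + w / 2) = w * (1 / 2) by lra.
have -> : w / 2 = w * (1 / 2) by lra.
by move: (1 / 2) => h; rewrite exprMn !exprS; ring.
Qed.

Lemma mass_gt0 (R : realType) (p : nat) (xi : seq R) (T : R) (i : nat) :
  open_knot_vector p xi -> (i < n_bsplines p xi)%N -> xi`_i < T <= 1 ->
  0 < mass p xi T i.
Proof.
move=> hxi hi /andP[aT T1]; have [e [c [e0 c0 hM]]] := mass_ge hxi hi.
pose w := Num.min (e / 2) (T - xi`_i).
have w0 : 0 < w by rewrite lt_min; apply/andP; split; lra.
have we : w <= e / 2 by rewrite ge_min lexx.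
have wT : w <= T - xi`_i by rewrite ge_min lexx orbT.
apply: lt_le_trans (hM w T _ _ T1); [|lra|lra].
by rewrite mulr_gt0 ?exprn_gt0.
Qed.

Lemma energy_mass_le (R : realType) (p : nat) (xi : seq R) (i : nat) :
  exists2 C : R, 0 < C & forall T, 0 <= T <= 1 ->
    energy p xi T i <= C /\ mass p xi T i <= C.
Proof.
have [C C0 hC] := bspline_bounded xi p i.
have C2 : 0 < C ^+ 2 by rewrite exprn_gt0.
exists (C ^+ 2 + C); first lra.
move=> T T01; split.
  have : energy p xi T i <= C ^+ 2 * (T - 0).
    apply: le_Rintegral_cst_tail; [apply: integrable_dbspline_sqr; lra|lra|lra| |].
      by move=> x; lra.
    move=> x xT _; have [_] := hC x ltac:(lra).
    rewrite -[dbspline _ _ _ _ ^+ 2]real_normK ?num_real // => h.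
    by rewrite lerXn2r ?nnegrE // ltW.
  by nra.
have : mass p xi T i <= C * (T - 0).
  apply: le_Rintegral_cst_tail; [apply: integrable_bspline; lra|lra|lra| |].
    by move=> x; lra.
  move=> x xT _; have [+ _] := hC x ltac:(lra).
  exact/le_trans/ler_norm.
by nra.
Qed.

(** Up to [a] the spline has already collected the mass [m0], independent of [T], while the energy
    is bounded. *)
Lemma energy_le_mass (R : realType) (p : nat) (xi : seq R) (i : nat) (a : R) :
  open_knot_vector p xi -> (i < n_bsplines p xi)%N -> xi`_i < a <= 1 ->
  exists2 C : R, 0 < C & forall T, a <= T <= 1 ->
    energy p xi T i <= C * mass p xi T i.
Proof.
move=> hxi hi ia1; have a0 := open_knot_ge0 hxi hi.
have [e [c [e0 c0 hM]]] := mass_ge hxi hi.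
pose w := Num.min (e / 2) (a - xi`_i).
have w0 : 0 < w by rewrite lt_min; apply/andP; split; lra.
have we : w <= e / 2 by rewrite ge_min lexx.
have wT : w <= a - xi`_i by rewrite ge_min lexx orbT.
pose m0 := c * w ^+ (start_order p xi i).+1.
have m00 : 0 < m0 by rewrite mulr_gt0 ?exprn_gt0.
have [C C0 hC] := energy_mass_le p xi i.
exists (C / m0); first exact: divr_gt0.
move=> T aT; have [h _] := hC T ltac:(lra); apply: (le_trans h).
rewrite mulrAC ler_pdivlMr // ler_wpM2l //; first exact: ltW.
by apply: hM; lra.
Qed.

(** For q = 1 the derivative is at least c on an interval of fixed width w, so the energy is at
    least c^2 w, while the mass is at most [D]. *)
Lemma energy_ge_mass (R : realType) (p : nat) (xi : seq R) (i : nat) (a : R) :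
  open_knot_vector p xi -> (i < n_bsplines p xi)%N -> xi`_i < a <= 1 ->
  start_order p xi i = 1%N ->
  exists2 c : R, 0 < c & forall T, a <= T <= 1 ->
    c * mass p xi T i <= energy p xi T i.
Proof.
move=> hxi hi ia1 q1; have a0 := open_knot_ge0 hxi hi.
have [e [c [C [[e0 c0 C0] hB]]]] := bspline_near_start hxi hi.
pose w := Num.min (e / 2) (a - xi`_i).
have w0 : 0 < w by rewrite lt_min; apply/andP; split; lra.
have we : w <= e / 2 by rewrite ge_min lexx.
have wT : w <= a - xi`_i by rewrite ge_min lexx orbT.
have [D D0 hD] := energy_mass_le p xi i.
have c2w : 0 < c ^+ 2 * w by rewrite mulr_gt0 ?exprn_gt0.
exists (c ^+ 2 * w / D); first exact: divr_gt0.
move=> T aT; have [_ h] := hD T ltac:(lra).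
apply: (@le_trans _ _ (c ^+ 2 * w)).
  by rewrite mulrAC ler_pdivrMr // ler_wpM2l // ltW.
have -> : w = (xi`_i + w) - xi`_i by lra.
apply: ge_Rintegral_cst_sub; [apply: integrable_dbspline_sqr; lra|lra|lra| |].
  by move=> x _; exact: sqr_ge0.
move=> x xw; have [|_ _ /(_ q1) hc] := hB x; first lra.
by rewrite lerXn2r ?nnegrE; lra.
Qed.

(** The energy is at most C^2 delta^(2q-1) and the mass at least c1 delta^(q+1). The factor
    [delta ^+ 2] on the left avoids the exponent q - 2, negative for q = 1. *)
Lemma trimmed_energy_le_mass (R : realType) (p : nat) (xi : seq R) (i : nat) :
  open_knot_vector p xi -> (i < n_bsplines p xi)%N ->
  (0 < start_order p xi i)%N ->
  exists e C : R, [/\ 0 < e, 0 < C & forall delta, 0 < delta < e ->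
    xi`_i + delta <= 1 ->
    energy p xi (xi`_i + delta) i * delta ^+ 2 <=
    C * delta ^+ (start_order p xi i) * mass p xi (xi`_i + delta) i].
Proof.
move=> hxi hi q0; have a0 := open_knot_ge0 hxi hi.
have [e1 [c1 [e10 c10 hM]]] := mass_ge hxi hi.
have [e [c [C [[e0 c0 C0] hB]]]] := bspline_near_start hxi hi.
set q := start_order p xi i in q0 hM hB *; set a := xi`_i in a0 hM hB *.
exists (Num.min e e1), (C ^+ 2 / c1); split; first by rewrite lt_min e0.
  by rewrite divr_gt0 // exprn_gt0.
move=> dl; rewrite lt_min => /andP[d0 /andP[de de1]] dl1.
have : energy p xi (a + dl) i <= (C * dl ^+ q.-1) ^+ 2 * (a + dl - a).
  have Cd : 0 <= C * dl ^+ q.-1 by rewrite mulr_ge0 ?exprn_ge0 // ltW.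
  apply: le_Rintegral_cst_tail; [exact: integrable_dbspline_sqr|lra|exact: sqr_ge0| |].
    move=> x _ xa; have [|||_ ->] := @bspline_out _ xi p i x.
    - by case: hxi.
    - exact: knot_index_size.
    - by rewrite xa.
    - by rewrite expr2 mulr0.
  move=> x xT ax; have [|_ + _] := hB x; first lra.
  rewrite -[dbspline _ _ _ _ ^+ 2]real_normK ?num_real // => h.
  rewrite lerXn2r ?nnegrE //; apply: (le_trans h).
  by rewrite ler_wpM2l ?(ltW C0) // lerXn2r ?nnegrE; lra.
have := hM dl (a + dl) ltac:(lra) ltac:(lra) dl1.
set m := mass _ _ _ _; set k := energy _ _ _ _ => hm hk.
have dE : dl ^+ q = dl ^+ q.-1 * dl by rewrite -exprSr prednK.
apply: (@le_trans _ _ (C ^+ 2 * dl ^+ q * dl ^+ q.+1)).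
  apply: (le_trans (ler_wpM2r _ hk)); first by rewrite sqr_ge0.
  rewrite [dl ^+ q.+1]exprS dE le_eqVlt; apply/orP; left; apply/eqP.
  by move: (dl ^+ q.-1) => z; ring.
have -> : C ^+ 2 / c1 * dl ^+ q * m = C ^+ 2 * dl ^+ q * (m / c1) by ring.
rewrite ler_wpM2l //; first by rewrite mulr_ge0 ?sqr_ge0 ?exprn_ge0 // ltW.
by rewrite ler_pdivlMr // mulrC.
Qed.

(** For q = 1 the energy is at least c^2 delta and the mass at most C delta^2. *)
Lemma trimmed_energy_ge_mass (R : realType) (p : nat) (xi : seq R) (i : nat) :
  open_knot_vector p xi -> (i < n_bsplines p xi)%N -> start_order p xi i = 1%N ->
  exists e c : R, [/\ 0 < e, 0 < c & forall delta, 0 < delta < e ->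
    xi`_i + delta <= 1 ->
    c * mass p xi (xi`_i + delta) i <= energy p xi (xi`_i + delta) i * delta].
Proof.
move=> hxi hi q1; have a0 := open_knot_ge0 hxi hi.
have [e [c [C [[e0 c0 C0] hB]]]] := bspline_near_start hxi hi.
rewrite q1 in hB; set a := xi`_i in a0 hB *.
exists e, (c ^+ 2 / C); split=> //; first by rewrite divr_gt0 // exprn_gt0.
move=> dl d0 dl1.
have hm : mass p xi (a + dl) i <= C * dl * (a + dl - a).
  have Cd : 0 <= C * dl by rewrite mulr_ge0 // ltW //; lra.
  apply: le_Rintegral_cst_tail; [exact: integrable_bspline|lra|by []| |].
    move=> x _ xa; have [|||-> _ //] := @bspline_out _ xi p i x.
    - by case: hxi.
    - exact: knot_index_size.
    - by rewrite xa.
  move=> x xT ax; have [|/andP[_ +] _ _] := hB x; first lra.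
  by rewrite expr1 => h; apply: (le_trans h); rewrite ler_wpM2l ?(ltW C0) //; lra.
have hk : c ^+ 2 * (a + dl - a) <= energy p xi (a + dl) i.
  apply: ge_Rintegral_cst_sub; [exact: integrable_dbspline_sqr|lra|lra| |].
    by move=> x _; exact: sqr_ge0.
  move=> x xw; have [|_ _ /(_ erefl) hc] := hB x; first lra.
  by rewrite lerXn2r ?nnegrE ?(ltW c0) ?(le_trans (ltW c0) hc).
apply: (@le_trans _ _ (c ^+ 2 * dl * dl)).
  have -> : c ^+ 2 / C * mass p xi (a + dl) i = c ^+ 2 * (mass p xi (a + dl) i / C).
    by rewrite mulrAC mulrA.
  rewrite -mulrA ler_wpM2l ?sqr_ge0 // ler_pdivrMr //.
  by apply: (le_trans hm); rewrite le_eqVlt; apply/orP; left; apply/eqP; ring.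
by rewrite ler_wpM2r; [|lra|move: hk; rewrite addrAC subrr add0r].
Qed.

(** * Active splines and the trimmed eigenvalue problem *)

Lemma distinct_knotP (R : realType) (p : nat) (xi : seq R) (l : nat) :
  open_knot_vector p xi -> (0 < l)%N -> (l.+1 < size (distinct_knots xi))%N ->
  let a := distinct_knot xi l in let b := distinct_knot xi l.+1 in
  [/\ a \in xi, 0 < a, a < b, b <= 1 &
    forall i, (i < size xi)%N -> xi`_i < b -> xi`_i <= a].
Proof.
move=> [sxi xi01 _ _ _] l0; set D := distinct_knots xi => hl a b.
have leD : sorted <=%R D by exact: (subseq_sorted le_trans (undup_subseq xi)).
have sD : sorted <%R D by rewrite lt_sorted_uniq_le undup_uniq.
have memD k : (k < size D)%N -> D`_k \in xi by move=> hk; rewrite -mem_undup mem_nth.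
have incD j k : (j < k)%N -> (k < size D)%N -> D`_j < D`_k.
  move=> jk kD; have jD := ltn_trans jk kD.
  by rewrite (lt_sorted_ltn_nth 0 sD jD kD).
split.
- by apply: memD; lia.
- have /andP[D0 _] : 0 <= D`_0 <= 1 by apply/xi01/memD; lia.
  by apply: (le_lt_trans D0); apply: incD; lia.
- by apply: incD.
- by have /andP[] : 0 <= D`_l.+1 <= 1 by apply/xi01/memD.
- move=> i hi; have : xi`_i \in D by rewrite mem_undup mem_nth.
  move=> /(nthP 0)[k hk <-] kb; rewrite leNgt; apply/negP => ak.
  have lk : (l < k)%N.
    rewrite ltnNge; apply/negP => kl; move: ak; rewrite ltNge => /negP; apply.
    by apply: le_sorted_leq_nth; rewrite ?inE // (ltn_trans _ hl).
  have : D`_l.+1 <= D`_k.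
    by apply: le_sorted_leq_nth; rewrite ?inE.
  by rewrite leNgt kb.
Qed.

(** The support is a closure but the domain is open, so the spline is nonzero at some point of the
    domain, and that point is not left of its first knot. *)
Lemma active_lt (R : realType) (p : nat) (xi : seq R) (T : R)
    (i : 'I_(n_bsplines p xi)) :
  open_knot_vector p xi -> i \in active p xi T -> xi`_i < T.
Proof.
move=> [sxi _ _ _ _]; rewrite inE => /andP[/asboolP[y [cy yT]] _].
have [x [/= Bx xT]] : [set x | bspline xi p i x != 0] `&` `]0, T[ !=set0.
  apply: cy; apply: open_nbhs_nbhs; split=> //; exact: interval_open.
move: xT; rewrite in_itv /= => /andP[_]; apply: le_lt_trans.
rewrite leNgt; apply: contraNN Bx => xi_x; apply/eqP.
have [||-> //] := @bspline_out _ xi p i x sxi; last by rewrite xi_x.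
exact: knot_index_size (ltn_ord i).
Qed.

Lemma mem_active (R : realType) (p : nat) (xi : seq R) (T : R)
    (i : 'I_(n_bsplines p xi)) :
  open_knot_vector p xi -> xi`_i < T -> bspline xi p i 0 = 0 ->
  i \in active p xi T.
Proof.
move=> hxi iT B0; rewrite inE B0 eqxx andbT; apply/asboolP.
have a0 := open_knot_ge0 hxi (ltn_ord i).
have [e [c [C [[e0 c0 C0] hB]]]] := bspline_near_start hxi (ltn_ord i).
pose w := Num.min (e / 2) ((T - xi`_i) / 2).
have w0 : 0 < w by rewrite lt_min; apply/andP; split; lra.
have we : w <= e / 2 by rewrite ge_min lexx.
have wT : w <= (T - xi`_i) / 2 by rewrite ge_min lexx orbT.
exists (xi`_i + w); split; last by rewrite /trimmed_domain /= in_itv /=; lra.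
apply: subset_closure => /=.
have [|/andP[h _] _ _] := hB (xi`_i + w); first lra.
rewrite gt_eqF //; apply: lt_le_trans h.
by rewrite mulr_gt0 // exprn_gt0; lra.
Qed.

Lemma bspline_at_start (R : realType) (p : nat) (xi : seq R) (i : nat) :
  open_knot_vector p xi -> (i < n_bsplines p xi)%N ->
  (0 < start_order p xi i)%N -> bspline xi p i (xi`_i) = 0.
Proof.
move=> hxi hi q0; have [e [c [C [[e0 c0 C0] hB]]]] := bspline_near_start hxi hi.
have [|] := hB xi`_i; first by rewrite lexx ltrDl.
by rewrite subrr expr0n gtn_eqF // !mulr0 => /le_anti.
Qed.

Lemma bspline_at0 (R : realType) (p : nat) (xi : seq R) (i : nat) :
  open_knot_vector p xi -> (i < n_bsplines p xi)%N ->
  (0 < start_order p xi i)%N -> bspline xi p i 0 = 0.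
Proof.
move=> hxi hi q0; have := open_knot_ge0 hxi hi; rewrite le_eqVlt => /orP[/eqP i0|i0].
  by rewrite [X in bspline _ _ _ X]i0; exact: bspline_at_start.
have [||-> //] := @bspline_out _ xi p i 0 ltac:(by case: hxi); last by rewrite i0.
exact: knot_index_size.
Qed.

Lemma count_le_lt1 (R : realType) (p : nat) (xi : seq R) (a : R) :
  open_knot_vector p xi -> a < 1 -> (count (<= a) xi <= n_bsplines p xi)%N.
Proof.
move=> hxi a1; rewrite -(count_lt1 hxi).
by apply: sub_count => x xa; exact: le_lt_trans a1.
Qed.

(** The knot 0 fills positions 0 to p, so the spline of index 1 contains p of its p + 1 copies. It
    also shows that the active basis is never empty. *)
Lemma second_bspline (R : realType) (p : nat) (xi : seq R) :
  (0 < p)%N -> open_knot_vector p xi ->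
  [/\ (1 < n_bsplines p xi)%N, xi`_1 = 0 & start_order p xi 1 = 1%N].
Proof.
move=> p0 hxi; have [sxi xi01 c0 _ _] := hxi.
have lt0 : count (< 0) xi = 0%N.
  apply/eqP; rewrite -leqn0 leqNgt -has_count; apply/hasPn => x /xi01.
  by rewrite leNgt => /andP[].
have le0 : count (<= 0) xi = p.+1 by rewrite count_le_lt_mem lt0 c0.
have x1 : xi`_1 = 0 by apply: nth_count_eq => //; rewrite lt0 le0.
split=> //; last by rewrite /start_order x1 le0; lia.
by have := count_le_lt1 hxi (@ltr01 R); rewrite le0; lia.
Qed.

(** Starting at the last copy of [a], this spline has the highest order of vanishing there, which
    produces delta^(p-2). *)
Lemma last_bspline (R : realType) (p : nat) (xi : seq R) (a : R) :
  open_knot_vector p xi -> a \in xi -> a < 1 -> let i := (count (<= a) xi).-1 in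
  [/\ (i < n_bsplines p xi)%N, xi`_i = a & start_order p xi i = p].
Proof.
move=> hxi a_xi a1 i; have [sxi _ _ _ _] := hxi.
have := count_lt_le_mem a xi; rewrite a_xi => lt_c.
have h1 := count_le_lt1 hxi a1.
have ce0 : (0 < count (<= a) xi)%N by apply: leq_ltn_trans lt_c.
have xa : xi`_i = a.
  by apply: nth_count_eq => //; rewrite /i -ltnS prednK ?lt_c ?leqnn.
split=> //; first by rewrite /i prednK.
by rewrite /start_order xa /i; move: ce0; case: (count _ _) => // c _; lia.
Qed.

(** Containing all copies of [a], this spline has the lowest order of vanishing there; at xi_l the
    order is kappa_l + 1, and kappa_l = 0 yields delta^-1. *)
Lemma first_bspline (R : realType) (p : nat) (xi : seq R) (a : R) :
  open_knot_vector p xi -> a \in xi -> a < 1 -> let i := count (< a) xi in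
  [/\ (i < n_bsplines p xi)%N, xi`_i = a &
      start_order p xi i = (p.+1 - count_mem a xi)%N].
Proof.
move=> hxi a_xi a1 i; have [sxi _ _ _ _] := hxi.
have := count_lt_le_mem a xi; rewrite a_xi => lt_c.
have h1 := count_le_lt1 hxi a1.
have xa : xi`_i = a by apply: nth_count_eq => //; rewrite /i leqnn.
split=> //; first exact: leq_trans h1.
by rewrite /start_order xa /i count_le_lt_mem subnDl.
Qed.

Lemma start_order_ge (R : realType) (p : nat) (xi : seq R) (i : nat) :
  open_knot_vector p xi -> (i < n_bsplines p xi)%N ->
  (p.+1 - count_mem (xi`_i)%R xi <= start_order p xi i)%N.
Proof.
move=> hxi hi; have [sxi _ _ _ _] := hxi.
have := @count_le_sub_mult _ xi i sxi; have := knot_index_size hi.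
rewrite /start_order => h /(_ ltac:(lia)); lia.
Qed.

Lemma lumped_mass_gt0 (R : realType) (p : nat) (xi : seq R) (T : R)
    (i : 'I_(n_active p xi T)) :
  open_knot_vector p xi -> T <= 1 -> 0 < mass p xi T (enum_val i).
Proof.
move=> hxi T1; apply: mass_gt0 => //; rewrite T1 andbT.
exact: active_lt (enum_valP i).
Qed.

Lemma active_energy_le (R : realType) (p : nat) (xi : seq R) (l kappa : nat)
    (a := distinct_knot xi l) :
  (1 <= p)%N -> open_knot_vector p xi -> (0 < l)%N ->
  (l.+1 < size (distinct_knots xi))%N ->
  (1 <= knot_mult xi l <= p)%N -> knot_mult xi l = (p - kappa)%N ->
  exists2 C : 'I_(n_bsplines p xi) -> R, (forall i, 0 < C i) &
    \forall delta \near 0^'+, forall i, i \in active p xi (a + delta) ->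
      energy p xi (a + delta) i <=
      C i * (if kappa == 0%N then delta^-1 else 1) * mass p xi (a + delta) i.
Proof.
move=> hp hxi hl hl1 hm hk.
have [a_xi a0 ab b1 hgap] := distinct_knotP hxi hl hl1.
rewrite -/a in a_xi a0 ab hgap; set b := distinct_knot _ _ in ab b1 hgap.
have H (i : 'I_(n_bsplines p xi)) : exists C : R, 0 < C /\
    \forall delta \near 0^'+, i \in active p xi (a + delta) ->
      energy p xi (a + delta) i <=
      C * (if kappa == 0%N then delta^-1 else 1) * mass p xi (a + delta) i.
  have hi := ltn_ord i; have isz : (i < size xi)%N by have := knot_index_size hi; lia.
  (* Splines starting before xi_l have a bounded ratio, which is below the target since 1 <=
     1/delta. *)
  have [ia|ia] := ltP xi`_i a.
    have [C C0 hC] := @energy_le_mass _ p xi i a hxi hi ltac:(lra).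
    exists C; split=> //; near=> dl => act.
    have dl0 : 0 < dl by near: dl; exact: nbhs_right_gt.
    have dlb : dl < b - a by near: dl; apply: nbhs_right_lt; lra.
    apply: le_trans (hC _ _) _; first by lra.
    have g1 : 1 <= (if kappa == 0%N then dl^-1 else 1) :> R.
      by case: ifP => // _; rewrite invf_ge1 //; lra.
    have m0 : 0 < mass p xi (a + dl) i by apply: mass_gt0 => //; lra.
    by rewrite ler_wpM2r ?(ltW m0) // -{1}[C]mulr1 ler_wpM2l // ltW.
  (* Splines starting at the next distinct knot or later are inactive for small [delta]. *)
  have [ib|ib] := ltP xi`_i b; last first.
    exists 1; split=> //; near=> dl => act.
    have := active_lt hxi act; rewrite ltNge; apply: contraNP => _.
    apply: le_trans ib; rewrite -lerBrDl; apply: ltW.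
    by near: dl; apply: nbhs_right_lt; lra.
  have eq_ia : xi`_i = a by apply/le_anti; rewrite ia hgap.
  have hq := start_order_ge hxi hi; rewrite eq_ia in hq.
  have hq' : (kappa.+1 <= start_order p xi i)%N.
    by move: hq hm; rewrite -/(knot_mult xi l) hk; lia.
  have [|e [C [e0 C0 hC]]] := trimmed_energy_le_mass hxi hi; first by lia.
  rewrite eq_ia in hC.
  exists C; split=> //; near=> dl => act.
  have dl0 : 0 < dl by near: dl; exact: nbhs_right_gt.
  have dlb : dl < b - a by near: dl; apply: nbhs_right_lt; lra.
  have dle : dl < e by near: dl; apply: nbhs_right_lt; lra.
  have m0 : 0 < mass p xi (a + dl) i by apply: mass_gt0 => //; lra.
  have dl1 : dl <= 1 by lra.
  have dl2 : 0 < dl ^+ 2 by rewrite exprn_gt0.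
  (* After multiplication by delta^2 it remains to compare delta^q with delta if kappa = 0, and with
     delta^2 otherwise; both follow from q >= kappa + 1. *)
  rewrite -(ler_pM2r dl2); apply: le_trans (hC dl _ _) _; [lra|lra|].
  rewrite -!mulrA ler_wpM2l ?(ltW C0) // [mass _ _ _ _ * _]mulrC mulrA.
  rewrite ler_wpM2r ?(ltW m0) //.
  case: eqP => [k0|/eqP k0].
    rewrite expr2 mulKf ?gt_eqF // -[X in _ <= X]expr1.
    by apply: (ler_wiXn2l (ltW dl0) dl1); exact: (leq_trans (ltn0Sn kappa) hq').
  rewrite mul1r; apply: (ler_wiXn2l (ltW dl0) dl1).
  by apply: (leq_trans _ hq'); rewrite ltnS lt0n.
have [C hC] := choice H.
exists C; first by move=> i; case: (hC i).
by apply: filter_forall => i; case: (hC i).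
Unshelve. all: by end_near. Qed.

(** * From single splines to the eigenvalues of the trimmed problem *)

Lemma trimmed_eigenvaluesP (R : realType) (p : nat) (xi : seq R) (T : R) :
  open_knot_vector p xi -> T <= 1 ->
  let K := stiffness p xi T in let M := lumped_mass p xi T in
  ordered_gen_eigenvalues K M (gen_eigenvalues K M).
Proof.
move=> hxi T1 K M; rewrite /M lumped_massE.
apply: gen_eigenvaluesP; first exact: stiffness_sym.
by move=> i; rewrite mxE; exact: lumped_mass_gt0.
Qed.

Lemma trimmed_diag_ratio (R : realType) (p : nat) (xi : seq R) (T : R)
    (i : 'I_(n_active p xi T)) :
  stiffness p xi T i i / lumped_mass p xi T i i =
  energy p xi T (enum_val i) / mass p xi T (enum_val i).
Proof. by rewrite stiffness_diag lumped_massE !mxE eqxx mulr1n. Qed.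

Lemma min_diag_ratio_trimmed_le (R : realType) (p : nat) (xi : seq R) (T C : R)
    (i : 'I_(n_bsplines p xi)) :
  open_knot_vector p xi -> T <= 1 -> i \in active p xi T ->
  energy p xi T i <= C * mass p xi T i ->
  min_diag_ratio (stiffness p xi T) (lumped_mass p xi T) <= C.
Proof.
move=> hxi T1 act hC.
apply: le_trans (min_diag_ratio_le _ _ (enum_rank_in act i)) _.
rewrite trimmed_diag_ratio enum_rankK_in // ler_pdivrMr //.
by apply: mass_gt0 => //; rewrite T1 (active_lt hxi act).
Qed.

Lemma min_diag_ratio_trimmed_ge0 (R : realType) (p : nat) (xi : seq R) (T : R) :
  open_knot_vector p xi -> T <= 1 -> (0 < n_active p xi T)%N ->
  0 <= min_diag_ratio (stiffness p xi T) (lumped_mass p xi T).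
Proof.
move=> hxi T1 n0; apply: le_min_diag_ratio => // i.
by rewrite trimmed_diag_ratio divr_ge0 ?energy_ge0 // ltW // lumped_mass_gt0.
Qed.

Lemma bottom_gen_eigenvalue_le (R : realType) (p : nat) (xi : seq R) (T : R) :
  open_knot_vector p xi -> T <= 1 -> (0 < n_active p xi T)%N ->
  gen_eigenvalue (stiffness p xi T) (lumped_mass p xi T) 1 <=
  min_diag_ratio (stiffness p xi T) (lumped_mass p xi T).
Proof.
move=> hxi T1 n0; apply: le_min_diag_ratio => // i.
rewrite trimmed_diag_ratio -stiffness_diag.
have := trimmed_eigenvaluesP hxi T1; rewrite /= lumped_massE => h.
have m0 k : 0 < (\row_(i < n_active p xi T) mass p xi T (enum_val i)) 0 k.
  by rewrite mxE; exact: lumped_mass_gt0.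
have := ordered_gen_eigenvalues_min (stiffness_sym _ _ _) m0 h i.
by rewrite mxE.
Qed.

Lemma top_trimmed_eigenvalue_le (R : realType) (p : nat) (xi : seq R) (T g : R)
    (C : 'I_(n_bsplines p xi) -> R) :
  open_knot_vector p xi -> T <= 1 -> (0 < n_active p xi T)%N -> 0 <= g ->
  (forall i, 0 < C i) ->
  (forall i, i \in active p xi T -> energy p xi T i <= C i * g * mass p xi T i) ->
  gen_eigenvalue (stiffness p xi T) (lumped_mass p xi T) (n_active p xi T) <=
  (\sum_i C i) * g.
Proof.
move=> hxi T1 n0 g0 C0 hC.
have := trimmed_eigenvaluesP hxi T1; rewrite /= /gen_eigenvalue lumped_massE => h.
have m0 k : 0 < (\row_(i < n_active p xi T) mass p xi T (enum_val i)) 0 k.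
  by rewrite mxE; exact: lumped_mass_gt0.
apply: le_trans (top_gen_eigenvalue_le n0 m0 _ h) _.
  by move=> x; exact: stiffness_psd.
apply: (@le_trans _ _ (\sum_(i in active p xi T) C i * g)).
  rewrite [leRHS]big_enum_val; apply: ler_sum => i _.
  rewrite stiffness_diag ler_pdivrMr // mxE.
  exact: hC (enum_valP i).
(* Enlarging the sum to all splines makes the constant independent of [T]. *)
rewrite mulr_suml [leLHS]big_mkcond; apply: ler_sum => i _.
by case: ifP => // _; rewrite mulr_ge0 // ltW.
Qed.

Lemma top_trimmed_eigenvalue_ge (R : realType) (p : nat) (xi : seq R) (T c : R)
    (i : 'I_(n_bsplines p xi)) :
  open_knot_vector p xi -> T <= 1 -> i \in active p xi T -> 0 <= c ->
  c * mass p xi T i <= energy p xi T i ->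
  c / (n_bsplines p xi)%:R <=
  gen_eigenvalue (stiffness p xi T) (lumped_mass p xi T) (n_active p xi T).
Proof.
move=> hxi T1 act c0 hc.
have := trimmed_eigenvaluesP hxi T1; rewrite /= /gen_eigenvalue lumped_massE => h.
have m0 k : 0 < (\row_(i < n_active p xi T) mass p xi T (enum_val i)) 0 k.
  by rewrite mxE; exact: lumped_mass_gt0.
have K0 k : 0 <= stiffness p xi T k k by rewrite stiffness_diag energy_ge0.
have := top_gen_eigenvalue_ge (enum_rank_in act i) m0 K0 h.
rewrite stiffness_diag mxE enum_rankK_in //.
set s := _`_ _ => hs.
have mi : 0 < mass p xi T i by apply: mass_gt0; rewrite ?T1 ?(active_lt hxi act).
have cs : c <= (n_active p xi T)%:R * s.
  by apply: le_trans hs; rewrite ler_pdivlMr.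
have n0 : (0 < n_active p xi T)%N by rewrite /n_active; apply/card_gt0P; exists i.
have s0 : 0 <= s.
  by rewrite -(pmulr_rge0 _ (_ : 0 < (n_active p xi T)%:R)) ?ltr0n // (le_trans c0).
have N0 : (0 < n_bsplines p xi)%N by apply: leq_ltn_trans (ltn_ord i).
(* The number of active splines varies with [T] and is replaced by the total number. *)
rewrite ler_pdivrMr ?ltr0n //; apply: (le_trans cs).
rewrite mulrC ler_wpM2l // ler_nat /n_active.
by rewrite -[leqRHS]card_ord max_card.
Qed.

Lemma start_active (R : realType) (p : nat) (xi : seq R) (T : R)
    (i : 'I_(n_bsplines p xi)) :
  open_knot_vector p xi -> (0 < start_order p xi i)%N -> xi`_i < T ->
  i \in active p xi T.
Proof.
by move=> hxi q0 iT; apply: mem_active => //; exact: bspline_at0.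
Qed.

Theorem mainTheorem3 (R : realType) (p : nat) (xi : seq R) (l kappa : nat)
    (hp : (1 <= p)%N)
    (hxi : open_knot_vector p xi)
    (hl : (0 < l)%N) (hl1 : (l.+1 < size (distinct_knots xi))%N)
    (hm : (1 <= knot_mult xi l <= p)%N)
    (hkappa : knot_mult xi l = (p - kappa)%N) :
  let xil := distinct_knot xi l in
  let h := distinct_knot xi l.+1 - xil in
  let n delta := n_active p xi (xil + delta) in
  let K delta := stiffness p xi (xil + delta) in
  let M delta := lumped_mass p xi (xil + delta) in
  [/\ (forall delta, 0 < delta < h ->
         ordered_gen_eigenvalues (K delta) (M delta)
           (gen_eigenvalues (K delta) (M delta))),
      same_order
        (fun delta => gen_eigenvalue (K delta) (M delta) (n delta))
        (fun delta => if kappa == 0%N then delta^-1 else 1),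
      (forall delta, 0 < delta < h ->
         gen_eigenvalue (K delta) (M delta) 1
         <= min_diag_ratio (K delta) (M delta)) &
      (fun delta => min_diag_ratio (K delta) (M delta)) =O_ (0^'+)
        (fun delta => if (p <= 2)%N then 1 else delta ^+ (p - 2))].
Proof.
move=> a h n K M.
have [a_xi a0 ab b1 _] := distinct_knotP hxi hl hl1.
rewrite -/a in a_xi a0 ab.
have h0 : 0 < h by rewrite subr_gt0.
have T1 delta : 0 < delta < h -> a + delta <= 1 by rewrite /h; lra.
have a1 : a < 1 by lra.
have near_h : \forall delta \near 0^'+, 0 < delta < h.
  by near=> dl; apply/andP; split; near: dl; [exact: nbhs_right_gt|exact: nbhs_right_lt].
have near_lt e : 0 < e -> \forall delta \near 0^'+, delta < e :> R.
  exact: nbhs_right_lt.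
have [hi1 x1 q1] := second_bspline hp hxi.
pose i1 := Ordinal hi1.
have act1 delta : 0 < delta < h -> i1 \in active p xi (a + delta).
  by move=> hd; apply: start_active; rewrite ?q1 //= x1; lra.
have n0 delta : 0 < delta < h -> (0 < n delta)%N.
  by move=> hd; apply/card_gt0P; exists i1; exact: act1.
have x1a : xi`_i1 < a <= 1 by rewrite /= x1; lra.
split.
- by move=> dl hd; apply: trimmed_eigenvaluesP => //; exact: T1.
- have [C C0 hC] := active_energy_le hp hxi hl hl1 hm hkappa.
  have [c c0 hc] : exists2 c : R, 0 < c & \forall delta \near 0^'+,
      c * (if kappa == 0%N then delta^-1 else 1) <=
      gen_eigenvalue (K delta) (M delta) (n delta).
    have N0 : 0 < (n_bsplines p xi)%:R :> R by rewrite ltr0n (ltn_trans _ hi1).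
    case: eqP => [k0|_].
      have [hi xia qi] := first_bspline hxi a_xi a1.
      pose i := Ordinal hi.
      have qi1 : start_order p xi i = 1%N.
        by rewrite /= qi -/(knot_mult xi l) hkappa k0 subn0 subSnn.
      have [e [c [e0 c0 hc]]] := trimmed_energy_ge_mass hxi hi qi1.
      exists (c / (n_bsplines p xi)%:R); first exact: divr_gt0.
      near=> dl.
      have hd : 0 < dl < h by near: dl.
      have de : dl < e by near: dl; exact: near_lt.
      have T1d := T1 _ hd; have /andP[d0 _] := hd.
      rewrite mulrAC; apply: (@top_trimmed_eigenvalue_ge _ _ _ _ _ i) => //.
      + by apply: start_active => //; [rewrite qi1|rewrite /= xia; lra].
      + by rewrite divr_ge0 // ltW.
      + have := hc dl; rewrite xia d0 de => /(_ isT T1d).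
        by rewrite mulrAC ler_pdivrMr.
    have [c c0 hc] := energy_ge_mass hxi hi1 x1a q1.
    exists (c / (n_bsplines p xi)%:R); first exact: divr_gt0.
    near=> dl.
    have hd : 0 < dl < h by near: dl.
    have T1d := T1 _ hd.
    rewrite mulr1; apply: (@top_trimmed_eigenvalue_ge _ _ _ _ _ i1) => //.
    + exact: act1.
    + exact: ltW.
    + by apply: hc; lra.
  have S0 : 0 <= \sum_i C i by apply: sumr_ge0 => i _; exact: ltW.
  (* Adding [c] secures the required order of the two constants. *)
  exists c, (\sum_i C i + c); split; first by rewrite c0 lerDr.
  near=> dl.
  have hd : 0 < dl < h by near: dl.
  have /andP[d0 _] := hd.
  have g0 : 0 <= (if kappa == 0%N then dl^-1 else 1) :> R.
    by case: ifP => // _; rewrite invr_ge0 ltW.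
  apply/andP; split; first by near: dl.
  apply: (@le_trans _ _ ((\sum_i C i) * (if kappa == 0%N then dl^-1 else 1))).
    apply: top_trimmed_eigenvalue_le => //; [exact: T1|exact: n0|].
    by near: dl.
  by rewrite ler_wpM2r // lerDl ltW.
- by move=> dl hd; apply: bottom_gen_eigenvalue_le => //; [exact: T1|exact: n0].
apply/eqO_exP.
have norm_le delta k : 0 < delta < h -> min_diag_ratio (K delta) (M delta) <= k ->
    `|min_diag_ratio (K delta) (M delta)| <= k.
  move=> hd; rewrite ger0_norm //.
  by apply: min_diag_ratio_trimmed_ge0 => //; [exact: T1|exact: n0].
case: leqP => [p2|p2].
  have [C C0 hC] := energy_le_mass hxi hi1 x1a.
  exists C => //; near=> dl.
  have hd : 0 < dl < h by near: dl.
  have T1d := T1 _ hd.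
  apply: norm_le => //; rewrite normr1 mulr1.
  apply: (@min_diag_ratio_trimmed_le _ _ _ _ _ i1) => //; first exact: act1.
  by apply: hC; lra.
have [hi xia qi] := last_bspline hxi a_xi a1.
pose i := Ordinal hi.
have [|e [C [e0 C0 hC]]] := trimmed_energy_le_mass hxi hi; first by rewrite qi.
exists C => //; near=> dl.
have hd : 0 < dl < h by near: dl.
have de : dl < e by near: dl; exact: near_lt.
have T1d := T1 _ hd; have /andP[d0 _] := hd.
have dp : 0 < dl ^+ (p - 2) by rewrite exprn_gt0.
apply: norm_le => //; rewrite (gtr0_norm dp).
apply: (@min_diag_ratio_trimmed_le _ _ _ _ _ i) => //.
  by apply: start_active => //; [rewrite qi|rewrite /= xia; lra].
have := hC dl; rewrite qi xia d0 de => /(_ isT T1d).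
have -> : dl ^+ p = dl ^+ (p - 2) * dl ^+ 2 by rewrite -exprD subnK // ltnW.
by rewrite mulrA [_ * _ * mass _ _ _ _]mulrAC ler_pM2r // exprn_gt0.
Unshelve. all: by end_near. Qed.
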